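(* Let $\pi$ be an admissible combinatorial datum over an alphabet $\mathcal{A}$, let $\mathcal{R}$ be its Rauzy class, and assume that $\mathcal{R}$ contains a cyclic combinatorial datum $\pi^{(\ast)}$. Let $(f_\tau)_{\tau\in\Delta^{\mathcal{A}}}$ be a full family with combinatorial datum $\pi$. Then for any finite Rauzy path $\gamma:\pi\to\pi^{(\ast)}$ of length $r$ there exists $\tau=\tau(\gamma)\in\Delta^{\mathcal{A}}$ such that $$\gamma(f_{\tau(\gamma)},r)=\gamma.$$
   Context: **GIETs.** An alphabet $\mathcal{A}$ is a finite set with $d\ge 2$ elements. A combinatorial datum over $\mathcal{A}$ is a pair $\pi=(\pi_t,\pi_b)$ of bijections $\mathcal{A}\to\{1,\dots,d\}$; it is admissible if $\pi_t^{-1}\{1,\dots,k\}\ne\pi_b^{-1}\{1,\dots,k\}$ for all $k=1,\dots,d-1$. A right-open interval is $I=[a,b)$ with $a<b$, and $\mathrm{Cl}(I)=[a,b]$. A generalized interval exchange transformation (GIET) on $I$ with datum $\pi$ is a bijection $f:I\to I$ considered together with two partitions $\{I^t_\alpha(f)\}_{\alpha\in\mathcal{A}}$ and $\{I^b_\alpha(f)\}_{\alpha\in\mathcal{A}}$ of $I$ into right-open subintervals, where $I^t_\alpha(f)$ (resp. $I^b_\alpha(f)$) is in position $\pi_t(\alpha)$ (resp. $\pi_b(\alpha)$) counting from the left, such that for every $\alpha$ the restriction $f_\alpha:=f|_{I^t_\alpha(f)}:I^t_\alpha(f)\to I^b_\alpha(f)$ (a continuous branch) is an orientation preserving homeomorphism.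 $\mathcal{G}(\pi,I)$ is the set of these. The points $u^t_\alpha(f):=\inf I^t_\alpha(f)$ and $u^b_\alpha(f):=\inf I^b_\alpha(f)$ are the critical points and critical values of $f$. The set $\mathcal{G}(\pi,I)$ has the metric $\mathrm{Dist}(f,f'):=\sum_{\alpha}\mathrm{Dist}_H(\overline{G_{f_\alpha}},\overline{G_{f'_\alpha}})$, where $\overline{G_{f_\alpha}}$ is the closure in $[\mathrm{Cl}(I)]^2$ of the graph of $f_\alpha$ and $\mathrm{Dist}_H$ is the Hausdorff distance induced by the Euclidean distance of $\mathbb{R}^2$. **Degenerations.** For $\mathcal{A}'\subset\mathcal{A}$ with $1\le|\mathcal{A}'|=d'\le d-1$, the reduction $\pi'$ of $\pi$ to $\mathcal{A}'$ is the pair of bijections $\pi'_\epsilon:\mathcal{A}'\to\{1,\dots,d'\}$, $\epsilon\in\{t,b\}$, obtained by composing $\pi_\epsilon|_{\mathcal{A}'}$ with the increasing bijection $\pi_\epsilon(\mathcal{A}')\to\{1,\dots,d'\}$ (here $d'=1$ is allowed, and GIETs with datum $\pi'$ are defined as before). A degeneration of a GIET in $\mathcal{G}(\pi,I)$, $I=[a,b)$, is $D=G_f\cup S$, where the regular part $G_f$ is the graph of some $f\in\mathcal{G}(\pi',I)$, $\pi'$ a reduction of $\pi$ to some $\mathcal{A}'=:\mathcal{A}(D)$, and the singular part $S=(s_\alpha)_{\alpha\in\mathcal{A}\setminus\mathcal{A}'}$ is a family of points, labelled by $\mathcal{A}\setminus\mathcal{A}'$, in $(\{u^t_\alpha(f):\alpha\in\mathcal{A}'\}\cup\{b\})\times(\{u^b_\alpha(f):\alpha\in\mathcal{A}'\}\cup\{b\})$.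 Let $\widehat{\mathcal{G}}(\pi,I)$ be the union of $\mathcal{G}(\pi,I)$ and the set of all such degenerations (over all reductions); for $D=f\in\mathcal{G}(\pi,I)$ put $\mathcal{A}(D)=\mathcal{A}$, $S=\emptyset$. For $D\in\widehat{\mathcal{G}}(\pi,I)$ put $D_\alpha:=\overline{G_{f_\alpha}}$ if $\alpha\in\mathcal{A}(D)$ and $D_\alpha:=\{s_\alpha\}$ otherwise; the distance on $\widehat{\mathcal{G}}(\pi,I)$ is $\mathrm{Dist}(D,D'):=\sum_\alpha\mathrm{Dist}_H(D_\alpha,D'_\alpha)$. **Full families.** $\Delta^{\mathcal{A}}$ is the open standard simplex $\{\tau\in\mathbb{R}^{\mathcal{A}}:\tau_\alpha>0\ \forall\alpha,\ \sum_\alpha\tau_\alpha=1\}$ and $\overline{\Delta^{\mathcal{A}}}$ its closure. A full family over $\pi$ (with combinatorial datum $\pi$) is a family $(f_\tau)_{\tau\in\Delta^{\mathcal{A}}}$, $f_\tau=F(\tau)$, given by a map $F:\Delta^{\mathcal{A}}\to\mathcal{G}(\pi,[0,1))$ such that: (1) $F$ is continuous; (2) $u^b_\alpha(f_\tau)=\sum_{\pi_b(\chi)\le\pi_b(\alpha)-1}\tau_\chi$ for all $\tau$ and all $\alpha\in\mathcal{A}$; (3) $F$ extends to a continuous map $\widehat F:\overline{\Delta^{\mathcal{A}}}\to\widehat{\mathcal{G}}(\pi,[0,1))$. **Rauzy classes and paths.** For an admissible $\pi$ let $\alpha_t,\alpha_b$ be the letters with $\pi_t(\alpha_t)=\pi_b(\alpha_b)=d$.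 The top operation $R^t$ (winner $\alpha_t$, loser $\alpha_b$) gives $\widetilde\pi=R^t(\pi)$ with $\widetilde\pi_t=\pi_t$ and $\widetilde\pi_b(\chi)=\pi_b(\chi)$ if $\pi_b(\chi)\le\pi_b(\alpha_t)$, $\widetilde\pi_b(\alpha_b)=\pi_b(\alpha_t)+1$, $\widetilde\pi_b(\chi)=\pi_b(\chi)+1$ if $\pi_b(\alpha_t)+1\le\pi_b(\chi)\le d-1$. The bottom operation $R^b$ (winner $\alpha_b$, loser $\alpha_t$) is the same with the roles of $t$ and $b$ exchanged. A Rauzy class $\mathcal{R}$ is a set of admissible data invariant under $R^t$ and $R^b$ and minimal with this property. An arrow is a pair $(\pi,\epsilon)$, $\pi\in\mathcal{R}$, $\epsilon\in\{t,b\}$, going from $\pi$ to $R^\epsilon(\pi)$; a Rauzy path $\gamma=\gamma_1\ast\dots\ast\gamma_r$ of length $r$ is a concatenation of $r$ compatible arrows, and $\gamma:\pi\to\pi'$ means that it starts at $\pi$ and ends at $\pi'$ (length $0$ paths are the elements of $\mathcal{R}$). A datum $\pi$ is cyclic if the permutation $\pi_b\circ\pi_t^{-1}$ of $\{1,\dots,d\}$ is a cycle of maximal order $d$. **Rauzy induction.** Let $\pi$ be admissible, $f\in\mathcal{G}(\pi,I)$, and assume the renormalizability condition $u^t_{\alpha_t}(f)\ne u^b_{\alpha_b}(f)$. Put $\epsilon(f)=t$ if $u^t_{\alpha_t}(f)<u^b_{\alpha_b}(f)$ and $\epsilon(f)=b$ if $u^t_{\alpha_t}(f)>u^b_{\alpha_b}(f)$.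 Let $\widetilde I\subset I$ be the right-open interval with $\inf\widetilde I=\inf I$, $\sup\widetilde I=\max\{u^t_{\alpha_t}(f),u^b_{\alpha_b}(f)\}$. Then $\mathcal{Q}(f):=\widetilde f$ is the first return map of $f$ to $\widetilde I$, an element of $\mathcal{G}(R^{\epsilon(f)}(\pi),\widetilde I)$, with labelled intervals: if $\epsilon(f)=t$, $I^t_\chi(\widetilde f)=I^t_\chi(f)$ for $\chi\ne\alpha_t$ and $I^t_{\alpha_t}(\widetilde f)=I^t_{\alpha_t}(f)\setminus I^b_{\alpha_b}(f)$; if $\epsilon(f)=b$, $I^t_\chi(\widetilde f)=I^t_\chi(f)$ for $\chi\ne\alpha_t,\alpha_b$, $I^t_{\alpha_t}(\widetilde f)=f^{-1}(I^t_{\alpha_t}(f))$ and $I^t_{\alpha_b}(\widetilde f)=I^t_{\alpha_b}(f)\setminus f^{-1}(I^t_{\alpha_t}(f))$; in both cases $I^b_\chi(\widetilde f)=\widetilde f(I^t_\chi(\widetilde f))$. Put $f^{(0)}=f$ and $f^{(k+1)}=\mathcal{Q}(f^{(k)})$ as long as $f^{(k)}$ satisfies the renormalizability condition; $\pi^{(k)}$ is the datum of $f^{(k)}$, and $\gamma_{k+1}$ is the arrow $(\pi^{(k)},\epsilon(f^{(k)}))$. If $f^{(0)},\dots,f^{(r-1)}$ satisfy the condition, $f$ admits $r$ steps of the Rauzy induction and its Rauzy path up to time $r$ is $\gamma(f,r):=\gamma_1\ast\dots\ast\gamma_r$. The conclusion $\gamma(f_{\tau(\gamma)},r)=\gamma$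 includes that $f_{\tau(\gamma)}$ admits $r$ steps. *)

(* Defs.v *)
From HB Require Import structures.
From mathcomp Require Import all_boot all_order all_algebra perm.
From mathcomp Require Import all_classical all_reals all_analysis.
From mathcomp Require Import zify.
Set Implicit Arguments.
Unset Strict Implicit.
Unset Printing Implicit Defensive.
Import Order.TTheory GRing.Theory Num.Theory.
Import numFieldNormedType.Exports.

Inductive side := Top | Bot.

(* Positions are 0-based: position k in {1, ..., d} is the ordinal k - 1.
   Injectivity gives bijectivity, see [pos_bij]. *)
Record datum (T : finType) := Datum {
  rows : {ffun T -> 'I_#|T|} * {ffun T -> 'I_#|T|};
  rows_inj : injectiveb rows.1 && injectiveb rows.2 }.

HB.instance Definition _ (T : finType) := [isSub for @rows T].
HB.instance Definition _ (T : finType) := [Finite of datum T by <:].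

Section Datum.
Variable T : finType.
Implicit Types (pi : datum T) (p : {ffun T -> 'I_#|T|}) (C : {set datum T}).

Definition pos pi (e : side) : {ffun T -> 'I_#|T|} :=
  if e is Top then (rows pi).1 else (rows pi).2.

Lemma pos_inj pi e : injective (pos pi e).
Proof.
by case: pi => r rP; case/andP: (rP) => /injectiveP ? /injectiveP ?; case: e.
Qed.

Lemma pos_bij pi e : bijective (pos pi e).
Proof. by apply: inj_card_bij; [exact: pos_inj | rewrite card_ord]. Qed.

Lemma pos_onto pi e i : i \in codom (pos pi e).
Proof.
by apply: inj_card_onto; [exact: pos_inj | rewrite card_ord].
Qed.

Definition letter pi e (i : 'I_#|T|) : T := iinv (pos_onto pi e i).

Lemma letterK pi e : cancel (letter pi e) (pos pi e).
Proof. by move=> i; rewrite /letter f_iinv. Qed.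

(* The letter in the last position of a row; it exists as soon as T is
   nonempty. *)
Definition last_letter p : option T := [pick x | (p x).+1 == #|T|].

Definition admissible pi : bool :=
  [forall k : 'I_#|T|, (0 < k)%N ==>
    ([set x | (pos pi Top x < k)%N] != [set x | (pos pi Bot x < k)%N])%SET].

Lemma transition_subproof pi : injective (fun i => pos pi Bot (letter pi Top i)).
Proof. by move=> i j /pos_inj /(can_inj (@letterK pi Top)). Qed.

Definition transition pi : {perm 'I_#|T|} := perm (@transition_subproof pi).

Definition cyclic_datum pi : bool :=
  [forall i, #|porbit (transition pi) i| == #|T|].

(* The new row of the loser, given the row pw in which the winner is last and
   the row pl in which the loser is last. *)
Definition rauzy_row (pw pl : {ffun T -> 'I_#|T|}) : {ffun T -> 'I_#|T|} :=
  if last_letter pw is Some w then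
    [ffun x => if (pl x <= pl w)%N then pl x
               else insubd (pl x)
                 (if (pl x).+1 == #|T| then (pl w).+1 else (pl x).+1)]
  else pl.

Lemma val_rauzy_row pw (pl : {ffun T -> 'I_#|T|}) w x : last_letter pw = Some w ->
  rauzy_row pw pl x =
    (if (pl x <= pl w)%N then pl x : nat
     else if (pl x).+1 == #|T| then (pl w).+1 else (pl x).+1) :> nat.
Proof.
move=> ww; rewrite /rauzy_row ww ffunE; case: leqP => // lt_wx.
rewrite val_insubd ifT //; case: eqP => ?; have := ltn_ord (pl x); lia.
Qed.

Lemma rauzy_row_inj pw (pl : {ffun T -> 'I_#|T|}) : injective pl -> injective (rauzy_row pw pl).
Proof.
move=> pl_inj; case ww: (last_letter pw) => [w|]; last first.
  by rewrite /rauzy_row ww.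
move=> x y /(congr1 val) /=; rewrite !(val_rauzy_row _ _ ww) => exy.
apply: pl_inj; apply: ord_inj; move: exy.
move: (nat_of_ord (pl x)) (nat_of_ord (pl y)) (nat_of_ord (pl w)) => i j k.
by case: (leqP i); case: (leqP j); do ?case: eqP; lia.
Qed.

Lemma rauzy_subproof pi e :
  let r := if e is Top then (pos pi Top, rauzy_row (pos pi Top) (pos pi Bot))
           else (rauzy_row (pos pi Bot) (pos pi Top), pos pi Bot) in
  injectiveb r.1 && injectiveb r.2.
Proof.
by case: e; apply/andP; split; apply/injectiveP;
  do ?apply: rauzy_row_inj; apply: pos_inj.
Qed.

Definition rauzy (e : side) pi : datum T := Datum (rauzy_subproof pi e).

(* Invariant sets are required to be nonempty, otherwise set0 would be the
   only minimal one. *)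
Definition rauzy_class C : bool :=
  minset (fun X : {set datum T} =>
    [&& X != finset.set0, [forall pi in X, admissible pi] &
        [forall pi in X, (rauzy Top pi \in X) && (rauzy Bot pi \in X)]]) C.

Definition arrow : Type := datum T * side.

(* The starting point is recorded since a path may have length 0. *)
Record rpath := RPath { rstart : datum T; rarrows : seq arrow }.

Definition rend (g : rpath) : datum T :=
  foldl (fun _ a => rauzy a.2 a.1) (rstart g) (rarrows g).

Fixpoint compatible C pi (s : seq arrow) : Prop :=
  if s is (pi1, e) :: s1 then
    [/\ pi1 = pi, pi1 \in C & compatible C (rauzy e pi1) s1]
  else True.

Definition rauzy_path C (g : rpath) : Prop :=
  rstart g \in C /\ compatible C (rstart g) (rarrows g).

(* The increasing bijection from P to an initial segment of the positions. *)
Definition rank_in (P : {set 'I_#|T|}) (i : 'I_#|T|) : nat :=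
  #|[set j in P | (j < i)%N]%SET|.

Section Reduction.
Variables (pi : datum T) (B : {set T}).
Let S : finType := {x : T | x \in B}.

Lemma rank_subproof e (x : S) :
  (rank_in (pos pi e @: B) (pos pi e (val x)) < #|S|)%N.
Proof.
rewrite card_sig -[X in (_ < X)%N](card_imset _ (@pos_inj pi e)) /rank_in.
apply: proper_card; apply/properP; split.
  by apply/fintype.subsetP => j; rewrite inE => /andP[].
exists (pos pi e (val x)); first by apply: imset_f; exact: (valP x).
by rewrite inE ltnn andbF.
Qed.

Definition reduced_row e : {ffun S -> 'I_#|S|} :=
  [ffun x => Ordinal (rank_subproof e x)].

Lemma reduced_row_mono e (x y : S) :
  (pos pi e (val x) < pos pi e (val y))%N ->
  (reduced_row e x < reduced_row e y)%N.
Proof.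
rewrite !ffunE /= /rank_in => lt_xy; apply: proper_card; apply/properP; split.
  by apply/fintype.subsetP => j; rewrite !inE => /andP[-> /= /ltn_trans]; exact.
exists (pos pi e (val x)); last by rewrite inE ltnn andbF.
by rewrite inE lt_xy andbT; apply: imset_f; exact: (valP x).
Qed.

Lemma reduced_row_inj e : injective (reduced_row e).
Proof.
move=> x y exy; apply: val_inj; apply: (@pos_inj pi e); apply: val_inj => /=.
by case: (ltngtP (pos pi e (val x)) (pos pi e (val y))) => // /reduced_row_mono;
  rewrite exy ltnn.
Qed.

Lemma reduction_subproof :
  injectiveb (reduced_row Top, reduced_row Bot).1 &&
  injectiveb (reduced_row Top, reduced_row Bot).2.
Proof. by apply/andP; split; apply/injectiveP; apply: reduced_row_inj. Qed.

Definition reduction : datum S := Datum reduction_subproof.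

End Reduction.
End Datum.

Local Open Scope classical_set_scope.
Local Open Scope ring_scope.

Section Giet.
Variable R : realType.

Definition right_open (J : set R) : Prop :=
  exists u v : R, u < v /\ J = `[u, v[%classic.

Definition oriented_homeo (f : R -> R) (A B : set R) : Prop :=
  [/\ set_bij A B f,
      {in A &, {homo f : x y / x < y}},
      {within A, continuous f} &
      exists g : R -> R, {in A, cancel f g} /\ {within B, continuous g}].

(* The map is only relevant on the interval where the GIET is defined. *)
Record pregiet (T : finType) := PreGiet {
  gmap : R -> R;
  gint : side -> T -> set R }.

Section OneAlphabet.
Variable T : finType.
Implicit Types (pi : datum T) (f : pregiet T).

Definition giet pi (a b : R) f : Prop :=
  [/\ a < b,
      set_bij `[a, b[%classic `[a, b[%classic (gmap f),
      forall e, [/\ forall x, right_open (gint f e x),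
                    trivIset setT (gint f e),
                    \bigcup_x gint f e x = `[a, b[%classic &
                    forall x y, (pos pi e x < pos pi e y)%N ->
                      forall s t, gint f e x s -> gint f e y t -> s < t] &
      forall x, oriented_homeo (gmap f) (gint f Top x) (gint f Bot x)].

(* critical points (e = Top) and critical values (e = Bot) *)
Definition crit f (e : side) (x : T) : R := inf (gint f e x).

Definition closed_graph f (x : T) : set (R * R) :=
  closure [set z | gint f Top x z.1 /\ z.2 = gmap f z.1].

End OneAlphabet.

Section Degenerations.
Variable T : finType.

Record degen := Degen {
  dletters : {set T};
  dregular : pregiet {x : T | x \in dletters};
  dsingular : T -> R * R (* only relevant outside dletters *) }.

Definition degeneration (pi : datum T) (a b : R) (D : degen) : Prop :=
  [/\ (1 <= #|dletters D| <= #|T|.-1)%N,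
      giet (reduction pi (dletters D)) a b (dregular D) &
      forall x, x \notin dletters D ->
        ((exists y, (dsingular D x).1 = crit (dregular D) Top y) \/
           (dsingular D x).1 = b) /\
        ((exists y, (dsingular D x).2 = crit (dregular D) Bot y) \/
           (dsingular D x).2 = b)].

Inductive preghat := Regular of pregiet T | Degenerate of degen.

Definition ghat (pi : datum T) (a b : R) (D : preghat) : Prop :=
  match D with
  | Regular f => giet pi a b f
  | Degenerate D => degeneration pi a b D
  end.

Definition piece (D : preghat) (x : T) : set (R * R) :=
  match D with
  | Regular f => closed_graph f x
  | Degenerate D => if insub x is Some y then closed_graph (dregular D) y
                    else [set dsingular D x]
  end.

Definition euclidean_dist (z w : R * R) : R :=
  Num.sqrt ((z.1 - w.1) ^+ 2 + (z.2 - w.2) ^+ 2).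

Definition hausdorff_dist (A B : set (R * R)) : R :=
  Num.max (sup [set inf [set euclidean_dist z w | w in B] | z in A])
          (sup [set inf [set euclidean_dist z w | z in A] | w in B]).

Definition Dist (D D' : preghat) : R :=
  \sum_(x : T) hausdorff_dist (piece D x) (piece D' x).

Definition simplex : set (T -> R) :=
  [set t | (forall x, 0 < t x) /\ \sum_x t x = 1].

Definition closed_simplex : set (T -> R) :=
  [set t | (forall x, 0 <= t x) /\ \sum_x t x = 1].

Definition Dist_continuous (X : set (T -> R)) (F : (T -> R) -> preghat) : Prop :=
  forall t, X t -> forall eps : R, 0 < eps ->
    exists2 delta : R, 0 < delta &
      forall t', X t' -> (forall x, `|t x - t' x| < delta) ->
        Dist (F t) (F t') < eps.

(* Only the values of F on the open simplex are relevant. *)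
Definition full_family (pi : datum T) (F : (T -> R) -> pregiet T) : Prop :=
  [/\ forall t, simplex t -> giet pi 0 1 (F t),
      Dist_continuous simplex (fun t => Regular (F t)),
      forall t, simplex t -> forall x,
        crit (F t) Bot x = \sum_(y | (pos pi Bot y < pos pi Bot x)%N) t y &
      exists Fhat : (T -> R) -> preghat,
        [/\ forall t, closed_simplex t -> ghat pi 0 1 (Fhat t),
            forall t, simplex t -> Fhat t = Regular (F t) &
            Dist_continuous closed_simplex Fhat]].

End Degenerations.

Section RauzyInduction.
Variable T : finType.
Implicit Types (pi : datum T) (f : pregiet T).

Definition return_time (f : R -> R) (J : set R) (s : R) : nat :=
  get [set n | [/\ (0 < n)%N, J (iter n f s) &
                   forall m, (0 < m < n)%N -> ~ J (iter m f s)]].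

Definition first_return (f : R -> R) (J : set R) (s : R) : R :=
  iter (return_time f J s) f s.

(* One step of the induction for f on [a, b[, of type e, at and ab being the
   last letters of the top and bottom rows, and [a, c[ the new interval. *)
Definition rauzy_induced (a b c : R) (at_ ab : T) (e : side) f : pregiet T :=
  let g := first_return (gmap f) `[a, c[%classic in
  let top x :=
    match e with
    | Top => if x == at_ then gint f Top at_ `\` gint f Bot ab else gint f Top x
    | Bot =>
      let P := `[a, b[%classic `&` gmap f @^-1` gint f Top at_ in
      if x == at_ then P
      else if x == ab then gint f Top ab `\` P else gint f Top x
    end in
  PreGiet g (fun e' x => if e' is Top then top x else g @` top x).

(* The arrows of the first r steps of the Rauzy induction applied to f on
   [a, b[ with datum pi, or None if f does not admit r steps. *)
Fixpoint induction_arrows pi (a b : R) f (r : nat) : option (seq (arrow T)) :=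
  if r is r'.+1 then
    match last_letter (pos pi Top), last_letter (pos pi Bot) with
    | Some at_, Some ab =>
      let ut := crit f Top at_ in
      let ub := crit f Bot ab in
      if ut == ub then None else
      let e := if ut < ub then Top else Bot in
      let c := Num.max ut ub in
      omap (cons (pi, e))
        (induction_arrows (rauzy e pi) a c (rauzy_induced a b c at_ ab e f) r')
    | _, _ => None
    end
  else Some [::].

Definition rauzy_path_of pi (a b : R) f (r : nat) : option (rpath T) :=
  omap (RPath pi) (induction_arrows pi a b f r).

End RauzyInduction.
End Giet.

(* Main.v *)
From HB Require Import structures.
Require Import Defs.
From mathcomp Require Import all_boot all_order all_algebra perm.
From mathcomp Require Import zify.
Set Implicit Arguments.
Unset Strict Implicit.
Unset Printing Implicit Defensive.

(** The Rauzy path only records comparisons between endpoints of intervals, so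
    it is enough to prescribe the relative order of finitely many orbit
    segments.  Which order is read off an integer model: giving length 1 to
    every letter at the end of the path and adding the length of the loser to
    that of the winner at each arrow, backwards, produces integer lengths of
    sum N on pi ([lengths]).  The interval exchange with these lengths has the
    prescribed path and permutes the N unit cells.  If f is a GIET on [0, 1)
    with marked points 0 = x 0 < ... < x N = 1 such that f moves the marked
    points, and has its critical points and values among them, exactly as the
    model does ([realizes]), then each induction step takes the decision of the
    model and leaves a GIET of the same kind for the shortened path
    ([realizes_path]).

    The marked points are found as a fixed point of a Thurston pull-back map.
    A vector g of N gaps, a point of a closed simplex, gives marked points
    ([marks]); the marked points prescribe the lengths tau of the bottom
    intervals; and pulling the marked points back by the branches of f_tau gives
    new marked points, hence new gaps ([thurston]).  A fixed point with positive
    gaps is what is needed.  When some tau vanish, f_tau has to be read in the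
    extension of the family to degenerations: each branch is then a closed
    graph or a single point, in both cases a monotone curve on which either
    coordinate determines the other ([curve], [ghat_curve]), and these curves
    depend continuously on tau, so the map is continuous on the whole closed
    simplex ([pull_back_cont]) and Brouwer's theorem applies.

    No gap of a fixed point vanishes.  As the branches are strictly monotone
    both ways, the gap of a cell is zero exactly when the gap of its image cell
    is zero ([fixed_increasing]).  Because the final datum is cyclic, the model
    permutes its N cells in a single cycle ([one_cycle_path]), so all gaps
    would vanish, while their sum is 1.

    Brouwer's theorem for a simplex is derived from Scarf's lemma ([scarf]), a
    parity argument on a finite set with several linear orders, applied to the
    integer points of large simplices ([grid_scarf]). *)

(** * Scarf's lemma *)
Section Scarf.
Variables (I U : finType) (w : I -> U -> nat).
Hypothesis w_inj : forall i, injective (w i).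

(** Scarf's primitive sets, with no condition on the cardinal. *)
Definition dominant (B : {set U}) : bool :=
  [forall y, exists i, [forall x in B, w i y <= w i x]].

Lemma dominantP (B : {set U}) :
  reflect (forall y, exists i, forall x, x \in B -> w i y <= w i x) (dominant B).
Proof.
apply: (iffP forallP) => domB y.
  have /existsP[i /forallP Bi] := domB y.
  by exists i => x xB; have /implyP := Bi x; apply.
have [i Bi] := domB y; apply/existsP; exists i; apply/forallP => x.
by apply/implyP; apply: Bi.
Qed.

Lemma dominantS (A B : {set U}) : A \subset B -> dominant B -> dominant A.
Proof.
move=> /subsetP sAB /dominantP domB; apply/dominantP => y.
by have [i Bi] := domB y; exists i => x /sAB; apply: Bi.
Qed.

(** A dominant set with one element less than there are orders is a door.  Its
    elements are exactly the lowest elements of the orders, so exactly one of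
    them is lowest for two orders.  A room through the door is obtained by
    giving up the lowest element in one of these two orders. *)
Section Door.
Variables (A : {set U}) (a0 : U).
Hypotheses (a0A : a0 \in A) (cardA : #|A|.+1 = #|I|) (domA : dominant A).

Definition lowest i : U := [arg min_(x < a0 in A) w i x].

Lemma lowest_in i : lowest i \in A.
Proof. by rewrite /lowest; case: arg_minnP. Qed.

Lemma lowest_le i x : x \in A -> w i (lowest i) <= w i x.
Proof. by rewrite /lowest; case: arg_minnP => // y _ H /H. Qed.

Lemma lowest_uniq i x : x \in A -> w i x <= w i (lowest i) -> lowest i = x.
Proof.
move=> xA le_x; apply: (w_inj (i := i)); apply/eqP; rewrite eqn_leq le_x andbT.
exact: lowest_le.
Qed.

Lemma lowest_onto x : x \in A -> exists i, lowest i = x.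
Proof.
move=> xA; have /dominantP/(_ x)[i ix] := domA.
by exists i; apply: lowest_uniq => //; apply/ix/lowest_in.
Qed.

Lemma double_lowest : exists i1 i2, i1 != i2 /\ lowest i1 = lowest i2.
Proof.
have [|ninj] := boolP (injectiveb lowest).
  move=> /injectiveP linj.
  have : #|lowest @: setT| <= #|A|.
    by apply/subset_leq_card/subsetP => _ /imsetP[i _ ->]; apply: lowest_in.
  by rewrite card_imset // cardsT -cardA ltnn.
move/injectivePn: ninj => [i1 [i2 neq eq12]].
by exists i1, i2; split => //; rewrite eq_sym.
Qed.

(** The elements that compete for the place opened by giving up order i. *)
Definition above_but i y : Prop := forall j, j != i -> w j (lowest j) < w j y.

Lemma above_but_uniq i1 i2 y :
  i1 != i2 -> above_but i1 y -> above_but i2 y -> False.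
Proof.
move=> neq H1 H2; have /dominantP/(_ y)[j jy] := domA.
have : w j (lowest j) < w j y.
  by have [ji1|] := eqVneq j i1; [apply: H2; rewrite ji1 | apply: H1].
by rewrite ltnNge jy // lowest_in.
Qed.

(** Adding y to the door makes it the lowest element of exactly one order i,
    and the elements of A remain lowest in all the others; so i is one of the
    two orders sharing their lowest element, and y is the best competitor for
    i since a better one would beat the whole room. *)
Lemma room_above y : y \notin A -> dominant (y |: A) ->
  exists i, [/\ {in [set~ i] &, injective lowest}, above_but i y &
             forall z, above_but i z -> w i z <= w i y].
Proof.
move=> yA /dominantP domyA.
have [i iy] := domyA y.
have [f fP] : exists f : U -> I, forall x, x \in A ->
    forall x', x' \in y |: A -> w (f x) x <= w (f x) x'.
  have := fun x => domyA x; move/fin_all_exists => [f fP].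
  by exists f => x xA; apply: fP.
have lf x : x \in A -> lowest (f x) = x.
  by move=> xA; apply: lowest_uniq => //; apply: fP => //; rewrite setU1r ?lowest_in.
have flt x : x \in A -> w (f x) x < w (f x) y.
  move=> xA; rewrite ltn_neqAle fP ?setU11 // andbT.
  by apply: contraNneq yA => /w_inj <-.
have fneq x : x \in A -> f x != i.
  move=> xA; apply/eqP => fxi; have := flt x xA; rewrite fxi ltnNge iy //.
  by rewrite setU1r.
have finj : {in A &, injective f} by move=> x x' xA x'A e; rewrite -(lf x) // e lf.
have fim : f @: A = [set~ i].
  apply/eqP; rewrite eqEcard; apply/andP; split.
    by apply/subsetP => _ /imsetP[x xA ->]; rewrite !inE fneq.
  by rewrite card_in_imset // cardsC1 -cardA.
have fl j : j != i -> f (lowest j) = j.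
  move=> ji; have : j \in f @: A by rewrite fim !inE.
  by move=> /imsetP[x xA ->]; rewrite lf.
exists i; split.
- by move=> j j'; rewrite !inE => ji j'i e; rewrite -(fl j) // e fl.
- move=> j ji; rewrite -{1 3}(fl j ji); apply: flt; exact: lowest_in.
- move=> z Hz; have [j jz] := domyA z.
  have [ji|ji] := eqVneq j i; first by rewrite -ji jz // setU11.
  by have := Hz j ji; rewrite ltnNge jz // setU1r // lowest_in.
Qed.

Lemma above_room i i' y : i != i' -> lowest i = lowest i' -> above_but i y ->
  (forall z, above_but i z -> w i z <= w i y) ->
  y \notin A /\ dominant (y |: A).
Proof.
move=> ii' lii' Hy maxy; split.
  apply/negP => /lowest_onto[j ljy].
  suff [k ki lky] : exists2 k, k != i & lowest k = y.
    by have := Hy k ki; rewrite lky ltnn.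
  have [ji|] := eqVneq j i; last by exists j.
  by exists i'; [rewrite eq_sym | rewrite -lii' -ji].
apply/dominantP => z.
have [zy|zy] := boolP [forall j, (j != i) ==> (w j (lowest j) < w j z)].
  have Hz : above_but i z by move=> j ji; have /forallP/(_ j)/implyP := zy; apply.
  exists i => x; rewrite !inE => /orP[/eqP->|xA]; first exact: maxy.
  have /dominantP/(_ z)[j jz] := domA.
  have [ji|ji] := eqVneq j i; first by rewrite -ji jz.
  by have := Hz j ji; rewrite ltnNge jz // lowest_in.
have /forallPn[j] := zy; rewrite negb_imply -leqNgt => /andP[ji jz].
exists j => x; rewrite !inE => /orP[/eqP->|xA].
  by apply: leq_trans jz (ltnW _); apply: Hy.
by apply: leq_trans jz _; apply: lowest_le.
Qed.

(** One room for each of the two orders i1, i2 sharing their lowest element.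
    The rooms differ, for an element competing for both would beat A. *)
Lemma door_two_rooms : (forall i, exists y, above_but i y) ->
  #|[set y | (y \notin A) && dominant (y |: A)]| = 2.
Proof.
move=> Hex; have [i1 [i2 [neq eql]]] := double_lowest.
have best i : exists y, above_but i y /\ forall z, above_but i z -> w i z <= w i y.
  pose P z := [forall j, (j != i) ==> (w j (lowest j) < w j z)].
  have PP z : reflect (above_but i z) (P z).
    apply: (iffP forallP) => H j; first by move=> ji; have /implyP := H j; apply.
    by apply/implyP; apply: H.
  have [y0 /PP Py0] := Hex i.
  case: (arg_maxnP (w i) Py0) => y /PP Hy maxy.
  by exists y; split => // z /PP; apply: maxy.
have [y1 [Hy1 max1]] := best i1; have [y2 [Hy2 max2]] := best i2.
have [y1A dom1] := above_room neq eql Hy1 max1.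
have [y2A dom2] : y2 \notin A /\ dominant (y2 |: A).
  by apply: (@above_room i2 i1) => //; rewrite eq_sym.
have y12 : y1 != y2.
  by apply/eqP => y12; apply: (above_but_uniq neq Hy1); rewrite y12.
suff -> : [set y | (y \notin A) && dominant (y |: A)] = [set y1; y2].
  by rewrite cards2 y12.
apply/setP => y; rewrite !inE; apply/idP/idP; last first.
  by move=> /orP[] /eqP->; rewrite ?y1A ?y2A.
move=> /andP[yA domy].
have [i [linj Hy maxy]] := room_above yA domy.
have /orP[/eqP i_eq|/eqP i_eq] : (i == i1) || (i == i2).
- apply: contraT; rewrite negb_or => /andP[n1 n2]; case/eqP: neq.
  by apply: linj => //; rewrite !inE eq_sym.
- apply/orP; left; apply/eqP/(w_inj (i := i1))/eqP.
  by subst i; rewrite eqn_leq max1 // maxy.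
- apply/orP; right; apply/eqP/(w_inj (i := i2))/eqP.
  by subst i; rewrite eqn_leq max2 // maxy.
Qed.

End Door.

(** Each order i has a slack element [s i], lowest for i and, in the other
    orders, above everything but slack elements.  Slack elements encode the
    orders that are left out, so that rooms all have the same cardinality.  Rooms and
    doors are counted through the doors whose colours are all the colours but
    i0. *)
Section Colouring.
Variables (s : I -> U) (v0 : U) (c : U -> I) (i0 : I).
Hypotheses (s_min : forall i y, w i (s i) <= w i y)
  (s_max : forall i j v, i != j -> v \notin codom s -> w j v < w j (s i))
  (v0s : v0 \notin codom s) (cs : cancel s c).

Definition room (B : {set U}) := (#|B| == #|I|) && dominant B.

(** A room of all colours is left through one door only, the one opened by
    removing the element of colour i0; in any other room that has such a door,
    the colours of two elements coincide and removing either opens a door. *)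
Lemma room_parity (B : {set U}) : room B ->
  odd #|[set y in B | c @: (B :\ y) == [set~ i0]]| = (c @: B == setT).
Proof.
move=> /andP[/eqP cardB _].
have inj1 y : y \in B -> c @: (B :\ y) == [set~ i0] -> {in B :\ y &, injective c}.
  move=> yB /eqP e; apply/imset_injP; rewrite e cardsC1 -cardB (cardsD1 y B) yB.
  by rewrite add1n.
have [full|nfull] := eqVneq.
  have cinj : {in B &, injective c} by apply/imset_injP; rewrite full cardsT cardB.
  have : i0 \in c @: B by rewrite full inE.
  move=> /imsetP[y0 y0B /esym cy0].
  suff -> : [set y in B | c @: (B :\ y) == [set~ i0]] = [set y0] by rewrite cards1.
  apply/setP => y; rewrite !inE; apply/andP/eqP => [[yB /eqP e]|->].
    apply/eqP; apply: contraT => yy0.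
    have : i0 \in [set~ i0] by rewrite -e -cy0 imset_f // !inE eq_sym yy0.
    by rewrite !inE eqxx.
  split=> //; apply/eqP/setP => i; rewrite !inE; apply/imsetP/idP.
    move=> [x]; rewrite !inE => /andP[xy0 xB] ->.
    by rewrite -cy0; apply: contraNneq xy0 => /cinj ->.
  move=> ii0; have : i \in c @: B by rewrite full inE.
  move=> /imsetP[x xB ix]; exists x => //; rewrite !inE xB andbT.
  by apply: contraNneq ii0 => xy0; rewrite ix xy0 cy0.
set S := [set y in B | _]; have [->|[y1]] := set_0Vmem S; first by rewrite cards0.
rewrite inE => /andP[y1B e1].
have cy1 : c y1 != i0.
  apply: contraNneq nfull => cy1; apply/eqP/setP => i; rewrite inE.
  have [->|ii0] := eqVneq i i0; first by rewrite -cy1 imset_f.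
  have : i \in c @: (B :\ y1) by rewrite (eqP e1) !inE.
  by apply/subsetP/imsetS/subD1set.
have : c y1 \in c @: (B :\ y1) by rewrite (eqP e1) !inE.
move=> /imsetP[y2 y2B' cy12].
have /andP[y21 y2B] : (y2 != y1) && (y2 \in B) by move: y2B'; rewrite !inE.
suff -> : S = [set y1; y2] by rewrite cards2 eq_sym y21.
apply/setP => y; rewrite !inE; apply/idP/idP.
  move=> /andP[yB ey]; apply: contraT; rewrite negb_or => /andP[n1 n2].
  case/eqP: y21; apply: (inj1 y yB ey) => //.
    by rewrite !inE eq_sym n2.
  by rewrite !inE eq_sym n1.
move=> /orP[] /eqP->; first by rewrite y1B.
rewrite y2B /= -(eqP e1) eqEsubset.
apply/andP; split; apply/subsetP => _ /imsetP[x xB ->].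
  have [->|xy1] := eqVneq x y1; first by rewrite cy12 imset_f // !inE y21.
  by apply: imset_f; move: xB; rewrite !inE xy1 => /andP[].
have [->|xy2] := eqVneq x y2.
  by rewrite -cy12 imset_f // !inE eq_sym y21.
by apply: imset_f; move: xB; rewrite !inE xy2 => /andP[].
Qed.

Definition outer : {set U} := s @: [set~ i0].

(** The outer door has a single room: the maximum y0 of the non-slack elements
    for i0 dominates, and no other element does. *)
Lemma outer_parity : #|[set y | (y \notin outer) && room (y |: outer)]| = 1.
Proof.
have cardO : #|outer|.+1 = #|I|.
  rewrite card_imset ?cardsC1 ?prednK //; last exact: can_inj cs.
  by apply/card_gt0P; exists i0.
case: (arg_maxnP (P := fun v => v \notin codom s) (w i0) v0s) => y0 y0s maxy0.
have y0O : y0 \notin outer.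
  by apply: contra y0s => /imsetP[i _ ->]; apply: codom_f.
suff -> : [set y | (y \notin outer) && room (y |: outer)] = [set y0] by rewrite cards1.
apply/setP => y; rewrite !inE; apply/idP/eqP => [/andP[yO /andP[_ /dominantP domy]]|->].
  have ys : y \notin codom s.
    apply/negP => /codomP[i yi].
    have ii0 : i = i0.
      by apply: contraNeq yO => ii0; rewrite yi imset_f // !inE.
    have [j jv] := domy v0.
    have : w j v0 <= w j (s j).
      apply: jv; have [->|ji0] := eqVneq j i0; first by rewrite -ii0 -yi setU11.
      by rewrite setU1r // imset_f // !inE.
    move=> le_v; case/negP: v0s; apply/codomP; exists j.
    by apply: (w_inj (i := j)); apply/eqP; rewrite eqn_leq le_v s_min.
  have [j jv] := domy y0.
  have ji0 : j = i0.
    apply: contraNeq y0s => ji0; apply/codomP; exists j.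
    apply: (w_inj (i := j)); apply/eqP; rewrite eqn_leq s_min andbT.
    by apply: jv; rewrite setU1r // imset_f // !inE.
  subst j; apply: (w_inj (i := i0)); apply/eqP; rewrite eqn_leq; apply/andP; split.
    exact: maxy0.
  by apply: jv; rewrite setU11.
rewrite y0O /= /room cardsU1 y0O add1n cardO eqxx /=; apply/dominantP => z.
have [/codomP[i ->]|zs] := boolP (z \in codom s); first by exists i.
exists i0 => x; rewrite !inE => /orP[/eqP->|/imsetP[i]]; first exact: maxy0.
by rewrite !inE => ii0 ->; apply/ltnW/s_max.
Qed.

(** A door other than the outer one contains an element that is not slack, and
    then [s i] competes for each order i, so [door_two_rooms] applies. *)
Lemma door_parity (A : {set U}) : c @: A = [set~ i0] ->
  odd #|[set y | (y \notin A) && room (y |: A)]| = (A == outer).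
Proof.
move=> cA; have [->|AO] := eqVneq; first by rewrite outer_parity.
set S := [set y | _]; have [->|[y]] := set_0Vmem S; first by rewrite cards0.
rewrite inE => /andP[yA /andP[/eqP cardyA domyA]].
have cardA : #|A|.+1 = #|I| by rewrite -cardyA cardsU1 yA.
have domA : dominant A by apply: dominantS domyA; apply: subsetUr.
have [a aA as_] : exists2 a, a \in A & a \notin codom s.
  apply/exists_inP; apply: contraNT AO => /exists_inPn Hs.
  rewrite eqEcard; apply/andP; split; last first.
    by rewrite card_imset ?cardsC1 -?cardA //; apply: can_inj cs.
  apply/subsetP => x xA; have := Hs x xA; rewrite negbK => /codomP[i xi].
  rewrite xi imset_f // -cA; apply/imsetP; exists x => //.
  by rewrite xi cs.
have -> : S = [set y | (y \notin A) && dominant (y |: A)].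
  apply/setP => x; rewrite !inE; case xA: (x \in A) => //=.
  by rewrite /room cardsU1 xA add1n cardA eqxx.
rewrite (door_two_rooms aA cardA domA) // => i; exists (s i) => j ji.
by apply: leq_ltn_trans (lowest_le aA j aA) _; apply: s_max => //; rewrite eq_sym.
Qed.

(** Counting the pairs (room, door) in two ways: modulo 2, the rooms contribute
    the number of rooms of all colours, the doors contribute 1. *)
Theorem scarf : exists B : {set U}, room B /\ c @: B = setT.
Proof.
pose E (B : {set U}) (y : U) := (y \in B) && room B && (c @: (B :\ y) == [set~ i0]).
have eqsum : \sum_(B : {set U}) \sum_y (E B y : nat) =
    \sum_(A : {set U}) \sum_y
      (((y \notin A) && room (y |: A) && (c @: A == [set~ i0])) : nat).
  rewrite exchange_big [RHS]exchange_big /=; apply: eq_bigr => y _.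
  rewrite (bigID (fun B : {set U} => y \in B)) /= addnC big1 ?add0n; last first.
    by move=> B yB; rewrite /E (negbTE yB).
  rewrite [RHS](bigID (fun B : {set U} => y \in B)) /=.
  rewrite [X in _ = X + _]big1 ?add0n; last first.
    by move=> B yB; rewrite yB.
  rewrite (reindex_onto (fun A => y |: A) (fun B => B :\ y)) /=; last first.
    by move=> B yB; rewrite setD1K.
  apply: eq_big => [A|A].
    rewrite setU11 /=; apply/eqP/idP => [<-|yA]; last by rewrite setU1K.
    by rewrite !inE eqxx.
  by move=> /andP[_ /eqP e]; rewrite /E setU11 /= e -{3}e !inE eqxx.
have big_odd (J : finType) (G : J -> nat) :
    odd (\sum_j G j) = \big[addb/false]_j odd (G j).
  by rewrite (big_morph odd oddD (erefl _)).
have /eqP := congr1 odd eqsum.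
rewrite !big_odd.
under eq_bigr => B _.
  have -> : odd (\sum_y E B y) = room B && (c @: B == setT).
    rewrite -big_mkcond /= sum1_card; case rB: (room B); last first.
      by rewrite eq_card0 // => y; rewrite -topredE /= andbF.
    rewrite -(room_parity rB); congr odd; apply: eq_card => y.
    by rewrite !inE -topredE /= andbT.
  over.
under [X in _ == X]eq_bigr => A _.
  have -> : odd (\sum_y ((y \notin A) && room (y |: A) && (c @: A == [set~ i0]))) =
      (A == outer).
    rewrite -big_mkcond /= sum1_card; case: eqP => cA; last first.
      rewrite eq_card0 => [|y]; last by rewrite -topredE /= andbF.
      apply/esym/negbTE/eqP => AO; apply: cA; rewrite AO /outer -imset_comp.
      rewrite (@eq_imset _ _ _ id) ?imset_id // => i /=; exact: cs.
    rewrite -(door_parity cA); congr odd; apply: eq_card => y.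
    by rewrite [RHS]inE -topredE /= andbT.
  over.
rewrite [X in _ == X](bigD1 outer) //= eqxx.
rewrite [X in true (+) X]big1 ?addbF; last by move=> A /negbTE.
move=> /eqP sumT.
have [/existsP[B /andP[rB /eqP cB]]|/existsPn none] :=
  boolP [exists B, room B && (c @: B == setT)]; first by exists B.
by move: sumT; rewrite big1 // => B _; apply: negbTE.
Qed.

End Colouring.
End Scarf.

(** Scarf's lemma for the integer points of the simplex of size m, ordered by
    each of their coordinates. *)
Section Grid.
Variables (I : finType) (i0 : I) (m : nat) (c : (I -> nat) -> I).

Local Notation point := {v : {ffun I -> 'I_m.+1} | \sum_i (v i : nat) == m}.
Definition coord (v : point) (i : I) : nat := val v i.

Lemma coord_sum v : \sum_i coord v i = m.
Proof. exact/eqP/(valP v). Qed.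

Lemma coord_le v i : coord v i <= m.
Proof. by rewrite -ltnS ltn_ord. Qed.

Lemma coord_onto (h : I -> nat) : \sum_i h i = m -> exists v, coord v =1 h.
Proof.
move=> hm.
have hle i : h i < m.+1 by rewrite ltnS -hm (bigD1 i) //= leq_addr.
pose f := [ffun i => (inord (h i) : 'I_m.+1)].
have fE i : f i = h i :> nat by rewrite ffunE inordK.
have fP : \sum_i (f i : nat) == m by rewrite (eq_bigr _ (fun i _ => fE i)) hm.
by exists (exist _ f fP) => i; rewrite /coord /= fE.
Qed.

(** Order i compares the i-th coordinates; the rank in an enumeration only
    breaks ties.  Slack elements are on the right of the sum type. *)
Definition weight (i : I) (u : point + I) : nat :=
  match u with
  | inl v => (coord v i * #|{: point}| + enum_rank v).+1
  | inr j => if j == i then 0 else (m.+1 * #|{: point}| + enum_rank j).+1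
  end.

Lemma weight_lt i v n : coord v i < n ->
  weight i (inl v) < (n * #|{: point}|).+1.
Proof.
move=> lt_n; apply: (@leq_trans ((coord v i).+1 * #|{: point}|).+1); last first.
  by rewrite ltnS leq_mul2r lt_n orbT.
by rewrite ltnS /= mulSn [leqRHS]addnC ltn_add2l ltn_ord.
Qed.

Lemma weight_inj i : injective (weight i).
Proof.
have aux v : weight i (inl v) < (m.+1 * #|{: point}|).+1.
  by apply: weight_lt; rewrite ltnS coord_le.
case=> [v|j] [v'|j'].
- move=> /= [] /(congr1 (modn ^~ #|{: point}|)).
  rewrite !modnMDl !modn_small ?ltn_ord // => /ord_inj/enum_rank_inj -> //.
- have := aux v; rewrite /=; case: eqP => //= _ lt_v [] e.
  by move: lt_v; rewrite e; lia.
- have := aux v'; rewrite /=; case: eqP => //= _ lt_v [] e.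
  by move: lt_v; rewrite -e; lia.
- rewrite /=; case: eqP => [->|_]; case: eqP => [->|_] // [] /addnI.
  by move=> /ord_inj/enum_rank_inj ->.
Qed.

(** Let C be the set of orders whose slack element is not in the room.  If the
    minima over the room of the coordinates in C had a sum at most m - #|C|,
    some point would exceed all of them by 1 and beat the room.  Hence these
    minima nearly exhaust the sum m: the coordinates of the room outside C are
    at most #|I|, and any two of its points differ by at most #|I|. *)
Lemma grid_scarf : exists p : I -> nat, \sum_i p i = m /\ forall i,
  p i <= #|I| \/ exists v : I -> nat, [/\ \sum_i v i = m, c v = i &
    forall j, v j <= p j + #|I| /\ p j <= v j + #|I|].
Proof.
have [v0 _] : exists v, coord v =1 (fun i => if i == i0 then m else 0).
  by apply: coord_onto; rewrite -big_mkcond big_pred1_eq.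
pose cc (u : point + I) := match u with inl v => c (coord v) | inr j => j end.
have s_min i u : weight i (inr i) <= weight i u by rewrite /= eqxx.
have s_max i j u : i != j -> u \notin codom (@inr point I) ->
    weight j u < weight j (inr i).
  case: u => [v ij _|k _ /negP[]]; last exact: codom_f.
  rewrite [X in _ < X]/= (negbTE ij).
  by apply: leq_trans (_ : (m.+1 * #|{: point}|).+1 <= _);
    [apply: weight_lt; rewrite ltnS coord_le | rewrite ltnS leq_addr].
have v0s : inl v0 \notin codom (@inr point I) by apply/codomP => -[].
have [B [/andP[/eqP cardB /dominantP domB] cB]] :=
  scarf weight_inj i0 s_min s_max v0s (fun i => erefl : cc (inr i) = i).
pose C := [set i | inr i \notin B].
have inC u i : (forall x, x \in B -> weight i u <= weight i x) ->
    u \notin codom (@inr point I) -> i \in C.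
  move=> iu us; rewrite inE; apply/negP => iB.
  have := iu _ iB; case: u us {iu} => [v _|k /negP[]]; last exact: codom_f.
  by rewrite /= eqxx.
have [k kC] : exists k, k \in C.
  by have [k kv0] := domB (inl v0); exists k; apply: inC v0s.
have colour i : i \in C -> exists2 v, inl v \in B & c (coord v) = i.
  rewrite inE => iB; have : i \in cc @: B by rewrite cB inE.
  move=> /imsetP[[v|j] uB /= ij]; first by exists v.
  by move: iB; rewrite ij uB.
have [p pB _] := colour k kC.
pose vm i := [arg min_(v < p | inl v \in B) coord v i].
have vmB i : inl (vm i) \in B by rewrite /vm; case: arg_minnP.
have vm_le i v : inl v \in B -> coord (vm i) i <= coord v i.
  by rewrite /vm; case: arg_minnP => // v1 _ H /H.
have sum_big : m < \sum_(i in C) (coord (vm i) i).+1.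
  rewrite ltnNge; apply/negP => small.
  (* the surplus is put on the coordinate k, to reach the sum m *)
  pose h i := if i \in C then (coord (vm i) i).+1 +
    (if i == k then m - \sum_(i in C) (coord (vm i) i).+1 else 0) else 0.
  have hm : \sum_i h i = m.
    rewrite -big_mkcond big_split /= -big_mkcondr /=.
    rewrite [X in _ + X](big_pred1 k) ?subnKC // => i /=.
    by case: eqP => [->|]; rewrite ?kC ?andbF.
  have [z zh] := coord_onto hm.
  have [i iz] := domB (inl z).
  have iC : i \in C by apply: (inC (inl z)) => //; apply/codomP => -[].
  have := iz _ (vmB i); rewrite leqNgt => /negP; apply.
  have lt_z : coord (vm i) i < coord z i by rewrite zh /h iC leq_addr.
  apply: leq_trans (weight_lt (ltnSn _)) _.
  rewrite /= ltnS; apply: leq_trans (leq_addr _ _); rewrite leq_mul2r.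
  by apply/orP; right.
have CI : #|C| <= #|I| by apply: max_card.
have sum_big' : m < \sum_(i in C) coord (vm i) i + #|C|.
  move: sum_big; under eq_bigr => i _ do rewrite -addn1.
  by rewrite big_split /= sum1_card.
have sumB v : inl v \in B ->
    \sum_(i in C) coord v i + \sum_(i in ~: C) coord v i = m.
  move=> vB; rewrite -[RHS](coord_sum v) [RHS](bigID (mem C)) /=; congr (_ + _).
  by apply: eq_bigl => i; rewrite inE.
have offB v i : inl v \in B -> i \notin C -> coord v i <= #|I|.
  move=> vB iC; have := sumB v vB.
  rewrite [X in _ + X](bigD1 i) ?in_setC //=.
  have : \sum_(i in C) coord (vm i) i <= \sum_(i in C) coord v i.
    by apply: leq_sum => j _; apply: vm_le.
  have aux a b d e f h : m < f + b -> b <= d -> f <= e -> e + (h + a) = m -> h <= d.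
    by lia.
  exact: aux sum_big' CI.
have nearB v i : inl v \in B -> i \in C -> coord v i <= coord (vm i) i + #|I|.
  move=> vB iC; have := sumB v vB.
  move: sum_big'; rewrite (bigD1 i) //= [X in _ -> X + _ = _ -> _](bigD1 i) //=.
  have : \sum_(j in C | j != i) coord (vm j) j <= \sum_(j in C | j != i) coord v j.
    by apply: leq_sum => j _; apply: vm_le.
  have aux a b d e f g h : f <= e -> m < g + f + b -> h + e + a = m -> b <= d ->
    h <= g + d by lia.
  by move=> le_s lt_m eq_m; apply: (aux _ _ _ _ _ _ _ le_s lt_m eq_m).
have closeB v v' i : inl v \in B -> inl v' \in B -> coord v i <= coord v' i + #|I|.
  move=> vB v'B; have [iC|iC] := boolP (i \in C).
    by apply: leq_trans (nearB v i vB iC) _; rewrite leq_add2r vm_le.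
  by apply: leq_trans (offB v i vB iC) _; rewrite leq_addl.
exists (coord p); split=> [|i]; first exact: coord_sum.
have [iC|iC] := boolP (i \in C); last by left; apply: offB.
have [v vB cv] := colour i iC; right; exists (coord v); split=> //.
  exact: coord_sum.
by move=> j; split; apply: closeB.
Qed.

End Grid.

(** * Integer lengths along a Rauzy path *)
Definition flip (e : side) : side := if e is Top then Bot else Top.

Section Lengths.
Variable T : finType.
Implicit Types (pi : datum T) (e : side) (lam : T -> nat) (x y w l : T).

(** The left endpoint of the interval of x in row e, for the lengths lam. *)
Definition offs pi e lam x : nat := \sum_(y | pos pi e y < pos pi e x) lam y.

Lemma last_letterE pi e x : last_letter (pos pi e) = Some x ->
  forall y, ((pos pi e y).+1 == #|T|) = (y == x).
Proof.
rewrite /last_letter; case: pickP => // x' lx [<-] y.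
apply/eqP/eqP => [ly|-> //]; last exact/eqP.
apply: (@pos_inj _ pi e); apply: val_inj; apply: succn_inj => /=.
by rewrite ly (eqP lx).
Qed.

Lemma last_letterP pi e x : last_letter (pos pi e) = Some x ->
  forall y, pos pi e y <= pos pi e x ?= iff (y == x).
Proof.
move=> lx y; split; last by rewrite (inj_eq val_inj) (inj_eq (@pos_inj _ pi e)).
have := last_letterE lx x; rewrite eqxx => /eqP lx'.
by rewrite -ltnS lx' ltn_ord.
Qed.

Lemma last_letter_ex pi e : 0 < #|T| -> exists x, last_letter (pos pi e) = Some x.
Proof.
move=> T0; have lt_T : #|T|.-1 < #|T| by rewrite prednK.
rewrite /last_letter; case: pickP => [x _|/(_ (letter pi e (Ordinal lt_T)))].
  by exists x.
by rewrite letterK /= prednK // eqxx.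
Qed.

Lemma admissible_last pi x y : 1 < #|T| -> admissible pi ->
  last_letter (pos pi Top) = Some x -> last_letter (pos pi Bot) = Some y -> x != y.
Proof.
move=> T1 /forallP adm lx ly; apply/eqP => xy; subst y.
have lt_T : #|T|.-1 < #|T| by rewrite prednK // ltnW.
have k0 : 0 < #|T|.-1 by rewrite -subn1 subn_gt0.
have /implyP/(_ k0) := adm (Ordinal lt_T).
have row e : last_letter (pos pi e) = Some x ->
    [set z | (pos pi e z < #|T|.-1)] = [set~ x].
  move=> lex; apply/setP => z; rewrite !inE.
  rewrite -(last_letterE lex) -ltnS prednK ?(ltnW T1) // ltn_neqAle andbC.
  by rewrite ltn_ord.
by rewrite !row ?eqxx.
Qed.

Lemma offs_total pi e lam x : offs pi e lam x + lam x <= \sum_y lam y.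
Proof.
rewrite (bigID (fun y => pos pi e y < pos pi e x)) /= leq_add2l.
by rewrite (bigD1 x) /= ?ltnn // leq_addr.
Qed.

Lemma offs_before pi e lam x y : pos pi e x < pos pi e y ->
  offs pi e lam x + lam x <= offs pi e lam y.
Proof.
move=> xy; rewrite [leqRHS]/offs (bigID (fun z => pos pi e z < pos pi e x)) /=.
apply: leq_add.
  rewrite /offs (eq_bigl (fun z => (pos pi e z < pos pi e y) &&
    (pos pi e z < pos pi e x))) // => z.
  by case: (ltnP (pos pi e z) (pos pi e x)) => [/ltn_trans/(_ xy) ->|]; rewrite ?andbF.
by rewrite (bigD1 x) /= ?xy ?ltnn // leq_addr.
Qed.

Lemma offs_last pi e lam x : last_letter (pos pi e) = Some x ->
  offs pi e lam x + lam x = \sum_y lam y.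
Proof.
move=> lx; rewrite [RHS](bigD1 x) //= addnC; congr (_ + _).
by apply: eq_bigl => y; rewrite ltn_neqAle !(last_letterP lx y) andbT.
Qed.

Lemma pos_last pi e x : last_letter (pos pi e) = Some x ->
  forall y, (y == x) || (pos pi e y < pos pi e x).
Proof.
move=> lx y; rewrite ltn_neqAle !(last_letterP lx y) andbT.
exact: orbN.
Qed.

Lemma pos_next pi e x : last_letter (pos pi e) != Some x ->
  exists y, forall z,
    (pos pi e z < pos pi e y) = (z == x) || (pos pi e z < pos pi e x).
Proof.
move=> nlx; have lt_x : (pos pi e x).+1 < #|T|.
  rewrite ltn_neqAle ltn_ord andbT; apply: contra nlx => lx.
  have [z lz] := last_letter_ex pi e (leq_trans (ltn0Sn _) (ltn_ord (pos pi e x))).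
  by move: lx; rewrite (last_letterE lz) => /eqP ->; rewrite lz.
exists (letter pi e (Ordinal lt_x)) => z; rewrite letterK /= ltnS leq_eqVlt.
by rewrite (inj_eq val_inj) (inj_eq (@pos_inj _ pi e)).
Qed.

Lemma offs_inj pi e lam x y i j : i < lam x -> j < lam y ->
  offs pi e lam x + i = offs pi e lam y + j -> x = y.
Proof.
move=> ix jy eqij; apply: (@pos_inj _ pi e); apply: val_inj => /=.
by case: (ltngtP (pos pi e x) (pos pi e y)) => // lt_xy;
  have := offs_before lam lt_xy; lia.
Qed.

(** The unit cells of the integer model, indexed by their letter and their
    rank in the interval of that letter. *)
Definition slot lam : Type := {x : T & 'I_(lam x)}.

Definition slot_pos pi e lam (k : slot lam) : nat :=
  offs pi e lam (tag k) + tagged k.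

Lemma slot_pos_lt pi e lam (k : slot lam) : slot_pos pi e k < \sum_x lam x.
Proof.
apply: leq_trans (offs_total pi e lam (tag k)); rewrite ltn_add2l.
exact: ltn_ord.
Qed.

Lemma slot_pos_inj pi e lam : injective (@slot_pos pi e lam).
Proof.
move=> [x i] [y j]; rewrite /slot_pos /= => eqij.
have xy : x = y := offs_inj (ltn_ord i) (ltn_ord j) eqij.
by subst y; move/addnI/val_inj: eqij => ->.
Qed.

Lemma slot_pos_onto pi e lam n : n < \sum_x lam x ->
  exists k : slot lam, slot_pos pi e k = n.
Proof.
move=> nN; pose f k := Ordinal (@slot_pos_lt pi e lam k).
have finj : injective f by move=> k k' [] /slot_pos_inj.
have fN : #|'I_(\sum_x lam x)| <= #|{: {x : T & 'I_(lam x)}}|.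
  rewrite card_ord card_tagged sumnE big_map big_enum /= leq_eqVlt.
  by apply/orP; left; apply/eqP/eq_bigr => x _; rewrite card_ord.
have /codomP[k kn] := inj_card_onto finj fN (Ordinal nN).
by exists k; case: kn.
Qed.

(** One induction step of the model, with winner w and loser l: lam and lam'
    are the lengths before and after.  In both rows only the interval of the
    loser moves. *)
Section Step.
Variables (pi : datum T) (e : side) (w l : T) (lam lam' : T -> nat).
Hypotheses (w_last : last_letter (pos pi e) = Some w)
  (l_last : last_letter (pos pi (flip e)) = Some l) (wl : w != l)
  (lamE : forall x, lam x = lam' x + (if x == w then lam' l else 0)).

Let pi' := rauzy e pi.

Lemma step_total : \sum_x lam x = \sum_x lam' x + lam' l.
Proof.
rewrite (eq_bigr _ (fun x _ => lamE x)) big_split /=; congr (_ + _).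
by rewrite -big_mkcond big_pred1_eq.
Qed.

Lemma pos_winner x : pos pi' e x = pos pi e x.
Proof. by rewrite /pi'; case: e. Qed.

Lemma pos_loser x : pos pi' (flip e) x =
  (if (pos pi (flip e) x <= pos pi (flip e) w) then pos pi (flip e) x : nat
   else if x == l then (pos pi (flip e) w).+1 else (pos pi (flip e) x).+1) :> nat.
Proof.
have -> : pos pi' (flip e) = rauzy_row (pos pi e) (pos pi (flip e)).
  by rewrite /pi'; case: e.
rewrite (val_rauzy_row _ _ w_last); case: ifP => // _; congr (if _ then _ else _).
by rewrite (last_letterE l_last).
Qed.

Lemma offs_winner x : offs pi' e lam' x = offs pi e lam x.
Proof.
rewrite /offs; under eq_bigl => y do rewrite !pos_winner.
apply: eq_bigr => y yx; rewrite lamE; case: eqP => [yw|]; rewrite ?addn0 //.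
by move: yx; rewrite yw ltnNge (last_letterP w_last x).
Qed.

Let qw_lt : pos pi (flip e) w < pos pi (flip e) l.
Proof.
by rewrite ltn_neqAle !(last_letterP l_last w) (negbTE wl).
Qed.

Let qw_le : (pos pi (flip e) l <= pos pi (flip e) w) = false.
Proof. by rewrite leqNgt qw_lt. Qed.

(** For a letter after w the interval of w before it is shorter by lam' l, and
    the loser has been inserted before it. *)
Lemma offs_bystander x : x != l -> offs pi' (flip e) lam' x = offs pi (flip e) lam x.
Proof.
move=> xl; rewrite /offs (eq_bigr _ (fun x _ => lamE x)) big_split /= -big_mkcondr /=.
have xl' : pos pi (flip e) x < pos pi (flip e) l.
  by rewrite ltn_neqAle !(last_letterP l_last x) (negbTE xl).
have ltE y : y != l ->
    (pos pi' (flip e) y < pos pi' (flip e) x) = (pos pi (flip e) y < pos pi (flip e) x).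
  move=> yl; rewrite !pos_loser (negbTE xl) (negbTE yl).
  move: (nat_of_ord (pos pi (flip e) x)) (nat_of_ord (pos pi (flip e) y)).
  move: (nat_of_ord (pos pi (flip e) w)) => a b c.
  by case: (leqP b a); case: (leqP c a); lia.
rewrite big_mkcond (bigD1 l) //= -big_mkcondr /= addnC.
congr (_ + _).
  apply: eq_bigl => y; case: (eqVneq y l) => [->|/ltE -> //].
  by rewrite [RHS]ltnNge (ltnW xl').
rewrite !pos_loser eqxx qw_le (negbTE xl).
case: (leqP (pos pi (flip e) x) (pos pi (flip e) w)) => [xw|wx].
  rewrite ltnNge (leq_trans xw) //= big_pred0 // => y.
  by apply/andP => -[+ /eqP yw]; rewrite yw ltnNge xw.
rewrite ltnS wx (big_pred1 w) // => y.
by rewrite /=; case: (eqVneq y w) => [->|_] /=; rewrite ?wx ?andbF.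
Qed.

Lemma offs_loser : offs pi' (flip e) lam' l = offs pi (flip e) lam w + lam' w.
Proof.
rewrite /offs (eq_bigr (fun x => lam' x)
  (P := fun y => pos pi (flip e) y < pos pi (flip e) w)); last first.
  by move=> x xw; rewrite lamE; case: eqP xw => [->|]; rewrite ?ltnn ?addn0.
rewrite (bigD1 w) /=; last by rewrite !pos_loser eqxx leqnn qw_le.
rewrite addnC; congr (_ + _); apply: eq_bigl => y.
rewrite !pos_loser eqxx qw_le [RHS]ltn_neqAle andbC.
rewrite (inj_eq val_inj) (inj_eq (@pos_inj _ pi _)); congr (_ && _).
case: (leqP (pos pi (flip e) y)) => //.
by case: (y == l) => wy; lia.
Qed.

(** The last intervals of the two rows end at the same point. *)
Lemma offs_loser_old i : offs pi (flip e) lam l + i = offs pi e lam w + (lam' w + i).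
Proof.
have := offs_last lam w_last; have := offs_last lam l_last.
rewrite !lamE eqxx eq_sym (negbTE wl); lia.
Qed.

End Step.

(** The permutation of the unit cells, from their top to their bottom position,
    is a single cycle: an invariant set of cells is empty or full.  In this
    form the property passes to the first return map without a description of
    the permutation. *)
Definition one_cycle pi lam : Prop := forall Z : pred nat,
  (forall x i, i < lam x -> Z (offs pi Top lam x + i) = Z (offs pi Bot lam x + i)) ->
  (forall n, n < \sum_x lam x -> Z n) \/ (forall n, n < \sum_x lam x -> ~~ Z n).

(** An invariant set restricted to the induced interval is invariant for the
    induced model, hence empty or full there, and each removed cell is the
    image of a cell of the loser, which is in the induced interval. *)
Lemma one_cycle_step pi e w l lam lam' :
  last_letter (pos pi e) = Some w -> last_letter (pos pi (flip e)) = Some l ->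
  w != l -> (forall x, lam x = lam' x + (if x == w then lam' l else 0)) ->
  one_cycle (rauzy e pi) lam' -> one_cycle pi lam.
Proof.
move=> wL lL wl lamE cyc Z ZP.
have {}ZP x i : i < lam x -> Z (offs pi e lam x + i) = Z (offs pi (flip e) lam x + i).
  by move=> ix; case: e {wL lL cyc} => /=; rewrite ZP.
have NE := step_total lamE.
have lamw : lam w = lam' w + lam' l by rewrite lamE eqxx.
have laml : lam l = lam' l by rewrite lamE eq_sym (negbTE wl) addn0.
have Zl i : i < lam' l ->
    Z (offs pi e lam l + i) = Z (offs (rauzy e pi) (flip e) lam' l + i).
  move=> il; rewrite ZP ?laml // (offs_loser_old wL lL wl lamE).
  rewrite (offs_loser wL lL wl lamE) ZP ?addnA //.
  by rewrite lamw ltn_add2l.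
have {}cyc : (forall n, n < \sum_x lam' x -> Z n) \/
    (forall n, n < \sum_x lam' x -> ~~ Z n).
  apply: cyc => x i ix.
  suff : Z (offs (rauzy e pi) e lam' x + i) = Z (offs (rauzy e pi) (flip e) lam' x + i).
    by case: e {wL lL ZP Zl} => /= ->.
  rewrite (offs_winner wL lamE); have [xl|xl] := eqVneq x l.
    by subst x; apply: Zl.
  rewrite (offs_bystander wL lL wl lamE xl) ZP // lamE.
  by apply: leq_trans ix _; apply: leq_addr.
have low i : i < lam' l -> offs pi e lam l + i < \sum_x lam' x.
  move=> il; have := offs_total (rauzy e pi) e lam' l.
  by rewrite (offs_winner wL lamE); lia.
have top n : \sum_x lam' x <= n < \sum_x lam x ->
    exists2 i, i < lam' l & Z n = Z (offs pi e lam l + i).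
  have := offs_last lam lL; rewrite laml => eqN nN.
  exists (n - \sum_x lam' x); first by lia.
  by rewrite ZP ?laml; [congr Z | ]; lia.
case: cyc => ZN; [left | right] => n nN; have [|le_n] := ltnP n (\sum_x lam' x);
  by [apply: ZN | have [|i il ->] := top n; [rewrite le_n | apply/ZN/low]].
Qed.

Lemma one_cycle_cyclic pi : cyclic_datum pi -> one_cycle pi (fun=> 1).
Proof.
move=> /forallP cyc Z ZP.
have offs1 e x : offs pi e (fun=> 1) x = pos pi e x.
  rewrite /offs (reindex (letter pi e)) /=; last first.
    exists (pos pi e) => y _; first exact: letterK.
    by apply: (@pos_inj _ pi e); rewrite letterK.
  under eq_bigl => i do rewrite letterK.
  by rewrite -(big_ord_widen _ (fun=> 1)) ?(ltnW (ltn_ord _)) // sum1_card card_ord.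
have sumT : \sum_(x : T) 1 = #|T| by rewrite sum1_card.
have Ztr i : Z (transition pi i) = Z i.
  rewrite permE; have := ZP (letter pi Top i) 0 isT.
  by rewrite !addn0 !offs1 letterK.
have Zpow n i : Z ((transition pi ^+ n)%g i) = Z i.
  elim: n => [|n IHn]; first by rewrite expg0 perm1.
  by rewrite expgSr permM Ztr.
have Zall (i j : 'I_#|T|) : Z i = Z j.
  have /eqP full := cyc i; have : j \in porbit (transition pi) i.
    suff -> : porbit (transition pi) i = setT by rewrite inE.
    by apply/eqP; rewrite eqEcard subsetT cardsT card_ord full leqnn.
  by move=> /porbitP[n ->]; rewrite Zpow.
rewrite sumT; have [T0|T0] := posnP #|T|; first by left=> n; rewrite T0.
case Z0: (Z 0); [left | right] => n nT; have := Zall (Ordinal T0) (Ordinal nT);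
  by rewrite /= Z0 => <-.
Qed.

(** The lengths on the starting datum of the path s for which the lengths after
    the last step are all 1. *)
Fixpoint lengths (s : seq (arrow T)) : T -> nat :=
  if s is (pi, e) :: s1 then
    fun x => lengths s1 x +
      (if last_letter (pos pi e) == Some x then
         if last_letter (pos pi (flip e)) is Some y then lengths s1 y else 0
       else 0)
  else fun=> 1.

Lemma lengths_gt0 s x : 0 < lengths s x.
Proof. by elim: s => [|[pi e] s IHs] //=; rewrite ltn_addr. Qed.

Lemma path_step (C : {set datum T}) pi (e : side) (s : seq (arrow T)) :
  1 < #|T| -> {in C, forall pi, admissible pi} -> pi \in C ->
  exists w l, [/\ last_letter (pos pi e) = Some w,
    last_letter (pos pi (flip e)) = Some l, w != l &
    forall x, lengths ((pi, e) :: s) x =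
      lengths s x + (if x == w then lengths s l else 0)].
Proof.
move=> T1 Cadm piC; have T0 := ltnW T1.
have [w wL] := last_letter_ex pi e T0; have [l lL] := last_letter_ex pi (flip e) T0.
exists w, l; split=> //.
  case: e wL lL => /= wL lL; last rewrite eq_sym.
    exact: admissible_last (Cadm _ piC) wL lL.
  exact: admissible_last (Cadm _ piC) lL wL.
move=> x; rewrite /= wL lL; congr (_ + _).
by rewrite eq_sym (inj_eq Some_inj).
Qed.

Lemma one_cycle_path (C : {set datum T}) pi s :
  1 < #|T| -> {in C, forall pi, admissible pi} ->
  compatible C pi s -> cyclic_datum (rend (RPath pi s)) -> one_cycle pi (lengths s).
Proof.
move=> T1 Cadm; rewrite /rend /=; elim: s pi => [|[pi1 e] s IHs] pi.
  by move=> _ /= cyc; apply: one_cycle_cyclic.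
move=> /= [-> piC compat] cyc.
have [w [l [wL lL wl lamE]]] := path_step e s T1 Cadm piC.
exact: one_cycle_step wL lL wl lamE (IHs _ compat cyc).
Qed.

End Lengths.

From mathcomp Require Import all_classical all_reals all_analysis.
From mathcomp Require Import ring lra.
Import Order.TTheory GRing.Theory Num.Theory.
Import numFieldNormedType.Exports.

(** * Brouwer's fixed point theorem *)
Section Brouwer.
Local Open Scope classical_set_scope.
Local Open Scope ring_scope.
Variables (R : realType) (K : finType).

Definition cont_on (X : set (K -> R)) (h : (K -> R) -> R) : Prop :=
  forall g, X g -> forall e : R, 0 < e -> exists2 d : R, 0 < d &
    forall g', X g' -> (forall k, `|g k - g' k| < d) -> `|h g - h g'| < e.

Import ArrowAsProduct.
(** Sequential compactness of the cube, in the form of a cluster point. *)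
Lemma cluster_seq (p : nat -> K -> R) : (forall n k, 0 <= p n k <= 1) ->
  exists q : K -> R, forall e, 0 < e -> forall N, exists2 n, (N <= n)%N &
    forall k, `|q k - p n k| < e.
Proof.
move=> p01.
have cpt := @tychonoff K (fun=> R) (fun=> `[0, 1]%classic)
  (fun=> @segment_compact R 0 1).
have [|q [_ clq]] := cpt (p @ \oo) _.
  by exists 0%N => // n _ k /=; rewrite in_itv /= p01.
exists q => e e0 N.
have Fp : (p @ \oo) [set p n | n in [set n | (N <= n)%N]].
  by exists N => // n /= Nn; exists n.
have nq : \forall f \near q, forall k : K, `|q k - f k| < e.
  apply: (filter_forall (nbhs_filter q)) => k.
  have /cvgrPdist_lt/(_ e e0) := @proj_continuous K (fun=> R) k q.
  by [].
by have [f [[n Nn <-] fq]] := clq _ _ Fp nq; exists n.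
Qed.

Lemma simplex_le1 (g : K -> R) k : closed_simplex g -> 0 <= g k <= 1.
Proof.
move=> [g0 <-]; rewrite g0 (bigD1 k) //= lerDl.
by apply: sumr_ge0.
Qed.

(** A grid point v is coloured by some k with [v k <= Phi v k], which exists
    since both sides have the same sum.  [grid_scarf] gives points p n near
    which, for every k, this inequality holds up to an error tending to 0: when
    no near point has colour k, [p n k] itself is small.  A cluster point q
    satisfies [q k <= Phi q k] for all k, with equality since the sums agree. *)
Theorem brouwer_simplex (k0 : K) (Phi : (K -> R) -> K -> R) :
  (forall g, closed_simplex g -> closed_simplex (Phi g)) ->
  (forall k, cont_on (@closed_simplex R K) (fun g => Phi g k)) ->
  exists2 g, closed_simplex g & forall k, Phi g k = g k.
Proof.
move=> Phi_s Phi_c.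
pose sc (n : nat) (v : K -> nat) : K -> R := fun k => (v k)%:R / n.+1%:R.
have sc_s n v : (\sum_k v k)%N = n.+1 -> closed_simplex (sc n v).
  move=> vn; split=> [k|]; first by rewrite divr_ge0.
  by rewrite -mulr_suml -natr_sum vn divff.
have colour (g : K -> R) : exists k, closed_simplex g -> g k <= Phi g k.
  have [gs|] := pselect (closed_simplex g); last by exists k0.
  have [[k gk]|none] := pselect (exists k, g k <= Phi g k); first by exists k.
  exfalso; have lt_g k : Phi g k < g k.
    by rewrite ltNge; apply/negP => gk; apply: none; exists k.
  have [_ s1] := Phi_s _ gs; have [_ s2] := gs.
  have : \sum_k Phi g k < \sum_k g k.
    by apply: ltr_sum => //; apply/hasP; exists k0 => //; rewrite mem_index_enum.
  by rewrite s1 s2 ltxx.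
have [col colP] := choice colour.
pose dl (n : nat) : R := #|K|%:R / n.+1%:R.
have approx n : exists p : K -> R, closed_simplex p /\ forall k, exists y : K -> R,
    [/\ closed_simplex y, y k - dl n <= Phi y k &
        forall j, `|p j - y j| <= dl n].
  have [p [pn pP]] := grid_scarf k0 n.+1 (fun v => col (sc n v)).
  exists (sc n p); split=> [|k]; first exact: sc_s.
  have [pk|[v [vn cv vp]]] := pP k.
    exists (sc n p); split; first exact: sc_s.
      have [+ _] := Phi_s _ (sc_s n p pn); move=> /(_ k); apply: le_trans.
      by rewrite subr_le0 ler_pM2r ?invr_gt0 ?ltr0n // ler_nat.
    by move=> j; rewrite subrr normr0 divr_ge0.
  exists (sc n v); split; first exact: sc_s.
    have := colP (sc n v) (sc_s n v vn); rewrite cv; apply: le_trans.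
    by rewrite gerBl divr_ge0.
  move=> j; have [le1 le2] := vp j.
  rewrite /sc -mulrBl normrM [X in _ * X]ger0_norm ?invr_ge0 //.
  rewrite ler_pM2r ?invr_gt0 ?ltr0n // ler_norml.
  by move: le1 le2; rewrite -!(ler_nat R) !natrD => le1 le2; apply/andP; split; lra.
have [p pP] := choice approx.
have [q qP] := cluster_seq (fun n k => simplex_le1 k (pP n).1).
have dl_small e : 0 < e -> exists N, forall n, (N <= n)%N -> dl n < e.
  move=> e0; exists (Num.trunc (#|K|%:R / e)) => n Nn.
  rewrite /dl ltr_pdivrMr ?ltr0n // mulrC -ltr_pdivrMr //.
  by apply: lt_le_trans (truncnS_gt _) _; rewrite ler_nat.
have qs : closed_simplex q.
  split=> [k|].
    apply/ler_addgt0Pl => e e0; have [n _ /(_ k)] := qP e e0 0%N.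
    have [+ _] := (pP n).1; move=> /(_ k) p0 /ltr_normlP[+ _]; lra.
  apply/eqP; rewrite -subr_eq0 -normr_eq0 eq_le normr_ge0 andbT.
  apply/ler_addgt0Pl => e e0; rewrite addr0.
  have K0 : 0 < #|K|%:R :> R by rewrite ltr0n; apply/card_gt0P; exists k0.
  have [n _ qn] := qP (e / #|K|%:R) (divr_gt0 e0 K0) 0%N.
  have [_ <-] := (pP n).1; rewrite -sumrB; apply: le_trans (ler_norm_sum _ _ _) _.
  apply: (@le_trans _ _ (\sum_(k : K) e / #|K|%:R)).
    by apply: ler_sum => k _; apply/ltW/qn.
  by rewrite sumr_const -(mulr_natr (e / #|K|%:R)) divfK // gt_eqF.
exists q => //.
have ge_q k : q k <= Phi q k.
  apply/ler_addgt0Pr => e e0.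
  have e4 : 0 < e / 4%:R by rewrite divr_gt0.
  have [d d0 Phid] := Phi_c k q qs _ e4.
  pose d' := Num.min (d / 2%:R) (e / 4%:R).
  have d'0 : 0 < d' by rewrite lt_min e4 andbT divr_gt0.
  have [N dlN] := dl_small d' d'0.
  have [n Nn qn] := qP d' d'0 N.
  have [y [ys yk py]] := (pP n).2 k.
  have d'd : d' <= d / 2%:R by rewrite ge_min lexx.
  have d'e : d' <= e / 4%:R by rewrite ge_min lexx orbT.
  have qy j : `|q j - y j| < d' + d'.
    rewrite -(subrKA (p n j)); apply: le_lt_trans (ler_normD _ _) _.
    by apply: ltrD => //; apply: le_lt_trans (py j) _; apply: dlN.
  have dn := dlN n Nn.
  have [] : `|q k - y k| < d' + d' /\ `|Phi q k - Phi y k| < e / 4%:R.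
    by split=> //; apply: Phid => // j; have := qy j; lra.
  move=> /ltr_normlP[a1 a2] /ltr_normlP[b1 b2]; lra.
have [_ s1] := Phi_s q qs; have [_ s2] := qs.
have : \sum_k (Phi q k - q k) = 0 by rewrite sumrB s1 s2 subrr.
move=> /psumr_eq0P H k; apply/eqP; rewrite -subr_eq0; apply/eqP/H => // j _.
by rewrite subr_ge0.
Qed.

End Brouwer.

(** * Rauzy induction of a marked GIET *)
Section Dynamics.
Local Open Scope classical_set_scope.
Local Open Scope ring_scope.
Variable R : realType.
Implicit Types (f h : R -> R) (A J : set R) (s : R).

Lemma inf_min A (u : R) : A u -> lbound A u -> inf A = u.
Proof.
move=> Au lbu; apply/eqP; rewrite eq_le; apply/andP; split.
  by apply: ge_inf => //; exists u.
by apply: lb_le_inf => //; exists u.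
Qed.

Lemma inf_itvco (u v : R) : u < v -> inf `[u, v[ = u.
Proof.
move=> uv; apply: inf_min; first by rewrite /= in_itv /= lexx.
by move=> z /=; rewrite in_itv /= => /andP[].
Qed.

Lemma return_time_eq f J s n : (0 < n)%N -> J (iter n f s) ->
  (forall m, (0 < m < n)%N -> ~ J (iter m f s)) -> return_time f J s = n.
Proof.
move=> n0 Jn nJ; rewrite /return_time.
set P := [set k | _]; have Pn : P n by split.
have [get0 Jget nJget] : P (get P) := getI Pn.
apply/eqP; rewrite eqn_leq; apply/andP; split; rewrite leqNgt; apply/negP => lt_n.
  by apply: (nJget n); rewrite ?n0.
by apply: (nJ (get P)); rewrite ?get0.
Qed.

Lemma first_return1 f J s : J (f s) -> first_return f J s = f s.
Proof.
by move=> Js; rewrite /first_return (@return_time_eq _ _ _ 1) //; case.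
Qed.

Lemma first_return2 f J s : ~ J (f s) -> J (f (f s)) ->
  first_return f J s = f (f s).
Proof.
move=> nJ JJ; rewrite /first_return (@return_time_eq _ _ _ 2) // => -[|[|]] //.
Qed.

Variable x : nat -> R.
Hypothesis x_mono : {mono x : m n / (m <= n)%N >-> m <= n}.

Lemma x_lt m n : (x m < x n) = (m < n)%N.
Proof. by rewrite ltNge x_mono -ltnNge. Qed.

Definition cell (u n : nat) : set R := `[x u, x (u + n)%N[.

Lemma cellP u n s : cell u n s <-> x u <= s < x (u + n)%N.
Proof. by rewrite /cell /= in_itv. Qed.

Definition carries f (u u' n : nat) : Prop :=
  [/\ f @` cell u n = cell u' n,
      forall s t, cell u n s -> cell u n t -> s < t -> f s < f t &
      forall i, (i < n)%N -> f (x (u + i)%N) = x (u' + i)%N].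

Lemma carries_cell f u u' n s : carries f u u' n -> cell u n s -> cell u' n (f s).
Proof. by move=> [<- _ _] us; exists s. Qed.

Lemma carries_comp f u u' u'' n : carries f u u' n -> carries f u' u'' n ->
  carries (f \o f) u u'' n.
Proof.
move=> c1 c2; have [im1 hom1 pt1] := c1; have [im2 hom2 pt2] := c2; split.
- by rewrite -image_comp im1 im2.
- move=> s t us ut st /=.
  by apply: hom2; [exact: carries_cell us | exact: carries_cell ut | exact: hom1].
- by move=> i i_n /=; rewrite pt1 // pt2.
Qed.

Lemma carries_ext f h u u' n : (forall s, cell u n s -> h s = f s) ->
  carries f u u' n -> carries h u u' n.
Proof.
move=> hf [im hom pt]; split.
- by rewrite -im; apply: eq_imagel => s us; apply: hf.
- by move=> s t us ut st; rewrite !hf //; apply: hom.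
- move=> i i_n; rewrite hf ?pt //; apply/cellP.
  by rewrite x_mono x_lt leq_addr ltn_add2l.
Qed.

(** As marked points go to marked points, being to the left of the j-th one is
    preserved by f in both directions. *)
Lemma carries_sub f u u' n i m : (i + m <= n)%N ->
  carries f u u' n -> carries f (u + i) (u' + i) m.
Proof.
move=> imn c; have [im hom pt] := c.
have sub v s : cell (v + i) m s -> cell v n s.
  move=> /cellP/andP[s1 s2]; apply/cellP; apply/andP; split.
    by apply: le_trans s1; rewrite x_mono leq_addr.
  by apply: lt_le_trans s2 _; rewrite x_mono -addnA leq_add2l.
have pt' j : (j <= m)%N -> forall s, cell u n s ->
    (f s < x (u' + i + j)%N) = (s < x (u + i + j)%N).
  move=> jm s us; have [lt_n|le_n] := ltnP (i + j) n; last first.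
    have /cellP/andP[_ s1] := us; have /cellP/andP[_ s2] := carries_cell c us.
    rewrite (lt_le_trans s1) ?(lt_le_trans s2) // x_mono -addnA leq_add2l //.
  rewrite -!addnA -pt //.
  have uij : cell u n (x (u + (i + j))%N).
    by apply/cellP; rewrite x_mono x_lt leq_addr ltn_add2l.
  apply/idP/idP => [|lt_s]; last exact: hom.
  apply: contraTT; rewrite -!leNgt le_eqVlt => /orP[/eqP -> //|lt_s].
  by apply/ltW/hom.
split.
- rewrite predeqE => t; split.
    move=> [s us <-]; have s1 := sub _ _ us; move/cellP: us => /andP[us1 us2].
    apply/cellP; rewrite pt' // us2 andbT leNgt.
    by have := pt' 0%N isT s s1; rewrite !addn0 => ->; rewrite -leNgt.
  move=> ut; have := sub _ _ ut; rewrite -im => -[s us fs]; exists s => //.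
  move: ut; rewrite -fs => /cellP/andP[u1 u2]; apply/cellP.
  rewrite -(pt' m) // u2 andbT leNgt.
  by have := pt' 0%N isT s us; rewrite !addn0 => <-; rewrite -leNgt.
- by move=> s t us ut; apply: hom; apply: sub.
- by move=> j jm; rewrite -!addnA pt // (leq_trans _ imn) // ltn_add2l.
Qed.

Section OneAlphabet.
Variable T : finType.
Implicit Types (pi : datum T) (lam : T -> nat) (F : pregiet R T) (y w l : T).

Definition realizes pi lam F : Prop :=
  (forall e y, gint F e y = cell (offs pi e lam y) (lam y)) /\
  (forall y, carries (gmap F) (offs pi Top lam y) (offs pi Bot lam y) (lam y)).

Lemma cells_cover pi e lam s :
  x 0%N <= s < x (\sum_y lam y)%N -> exists y, cell (offs pi e lam y) (lam y) s.
Proof.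
move=> /andP[s0 sN].
have exn : exists n, s < x n by exists (\sum_y lam y)%N.
case: (ex_minnP exn) => -[|n] sn minn; first by move: sn; rewrite ltNge s0.
have ns : x n <= s by rewrite leNgt; apply/negP => /minn; rewrite ltnn.
have nN : (n < \sum_y lam y)%N by apply: minn.
have [[y i] /= yn] := slot_pos_onto pi e nN.
exists y; apply/cellP; apply/andP; split.
  by apply: le_trans ns; rewrite x_mono -yn leq_addr.
apply: lt_le_trans sn _; rewrite x_mono -yn /slot_pos /= -addnS leq_add2l.
exact: ltn_ord.
Qed.

(** Both types of steps are treated together: w is the winner, l the loser, and
    [at_], [ab] are the last letters of the top and bottom rows.  The interval
    shrinks from N to N' cells. *)
Section Step.
Variables (pi : datum T) (e : side) (w l : T) (lam lam' : T -> nat).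
Hypotheses (w_last : last_letter (pos pi e) = Some w)
  (l_last : last_letter (pos pi (flip e)) = Some l) (wl : w != l)
  (lamE : forall y, lam y = (lam' y + (if y == w then lam' l else 0))%N)
  (lam'_gt0 : forall y, (0 < lam' y)%N).
Variable F : pregiet R T.
Hypothesis realF : realizes pi lam F.

Let at_ := if e is Top then w else l.
Let ab := if e is Top then l else w.
Let N := (\sum_y lam y)%N.
Let N' := (\sum_y lam' y)%N.
Let pi' := rauzy e pi.

Lemma at_last : last_letter (pos pi Top) = Some at_.
Proof. by rewrite /at_; case: e w_last l_last. Qed.

Lemma ab_last : last_letter (pos pi Bot) = Some ab.
Proof. by rewrite /ab; case: e w_last l_last. Qed.

Lemma lam_gt0 y : (0 < lam y)%N.
Proof. by rewrite lamE ltn_addr. Qed.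

Lemma lam_w : lam w = (lam' w + lam' l)%N.
Proof. by rewrite lamE eqxx. Qed.

Lemma lam_other y : y != w -> lam y = lam' y.
Proof. by rewrite lamE => /negbTE ->; rewrite addn0. Qed.

Lemma lam_l : lam l = lam' l.
Proof. by rewrite lam_other // eq_sym. Qed.

Lemma offs_l : offs pi (flip e) lam l = N'.
Proof.
have := offs_last lam l_last; rewrite (step_total lamE) lam_l => /eqP.
by rewrite eqn_add2r => /eqP.
Qed.

Lemma offs_w : (offs pi e lam w + lam' w)%N = N'.
Proof.
have := offs_last lam w_last; rewrite (step_total lamE) lam_w addnA => /eqP.
by rewrite eqn_add2r => /eqP.
Qed.

Lemma crit_real e' y : crit F e' y = x (offs pi e' lam y).
Proof.
by rewrite /crit realF.1 inf_itvco // x_lt -[X in (X < _)%N]addn0 ltn_add2l lam_gt0.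
Qed.

Lemma crit_side : (crit F Top at_ == crit F Bot ab) = false /\
  (if crit F Top at_ < crit F Bot ab then Top else Bot) = e.
Proof.
rewrite !crit_real x_lt eq_le !x_mono.
have := offs_l; have := offs_w; have := lam'_gt0 w.
rewrite /at_ /ab; clear; case: e => /= h0 hw hl.
  have -> : (offs pi Top lam w < offs pi Bot lam l)%N by lia.
  by split=> //; lia.
have -> : (offs pi Top lam l < offs pi Bot lam w)%N = false by lia.
by split=> //; lia.
Qed.

Lemma crit_max : Num.max (crit F Top at_) (crit F Bot ab) = x N'.
Proof.
rewrite !crit_real; have := offs_l; have := offs_w; rewrite /at_ /ab.
case: e => /= hw hl.
  by rewrite max_r ?hl // x_mono -hw leq_addr.
by rewrite max_l ?hl // x_mono -hw leq_addr.
Qed.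

Let F' := rauzy_induced (x 0%N) (x N) (x N') at_ ab e F.

Lemma offs_other e' y : y != l -> offs pi' e' lam' y = offs pi e' lam y.
Proof.
move=> yl; have [->|->] : e' = e \/ e' = flip e by case: (e') (e) => -[]; auto.
  exact: (offs_winner w_last lamE).
exact: (offs_bystander w_last l_last wl lamE yl).
Qed.

Lemma other_below y : y != l -> (offs pi Bot lam y + lam' y <= N')%N.
Proof.
by move=> yl; rewrite -(offs_other Bot yl); apply: offs_total.
Qed.

Lemma cell_below u n s : (u + n <= N')%N -> cell u n s -> `[x 0%N, x N'[%classic s.
Proof.
move=> unN /cellP/andP[s1 s2]; rewrite /= in_itv /=; apply/andP; split.
  by apply: le_trans s1; rewrite x_mono.
by apply: lt_le_trans s2 _; rewrite x_mono.
Qed.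

(** The new branch of the loser is a composition: f sends its domain onto the
    removed interval, which f sends back into the induced interval.  The two
    factors are the branch of the loser and a piece of that of the winner, in
    an order that depends on the type of the step. *)
Lemma carries_l1 :
  carries (gmap F) (offs pi' Top lam' l) N' (lam' l) /\
  carries (gmap F) N' (offs pi' Bot lam' l) (lam' l).
Proof.
have ow := offs_w; have ol := offs_l.
have := offs_winner w_last lamE l; have := offs_loser w_last l_last wl lamE.
rewrite -/pi'; move: ow ol; have [_ car] := realF.
have carw := carries_sub (i := lam' w) (m := lam' l) (eq_leq (esym lam_w)) (car w).
have := car l; rewrite lam_l => carl.
rewrite /pi'; move: carw carl; case: (e) => /= carw carl ow ol -> ->;
  by move: carw carl; rewrite ow ol.
Qed.

Lemma last_before e' z y : last_letter (pos pi e') = Some z -> y != z ->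
  (offs pi e' lam y + lam y <= offs pi e' lam z)%N.
Proof.
move=> zL yz; apply: offs_before.
by rewrite ltn_neqAle !(last_letterP zL y) (negbTE yz).
Qed.

Lemma top_case : e = Top ->
  gint F Top w `\` gint F Bot l = cell (offs pi e lam w) (lam' w).
Proof.
move=> eT; have [gintF _] := realF; have ow := offs_w; have ol := offs_l.
have oN := offs_last lam w_last; have oN' := offs_last lam l_last.
move: ow ol oN oN'; rewrite !gintF eT /= => ow ol oN oN'.
rewrite predeqE => s; split.
  move=> [/cellP/andP[s1 s2] ns]; apply/cellP; rewrite s1 ow ltNge /=.
  by apply/negP => s3; apply/ns/cellP; rewrite oN' -oN ol s3.
move=> /cellP/andP[s1 s2]; split.
  by apply/cellP; rewrite s1 (lt_le_trans s2) // x_mono leq_add2l lam_w leq_addr.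
by move=> /cellP/andP[s3 _]; move: s2; rewrite ow -ol ltNge s3.
Qed.

(** Only the branch of the winner reaches the removed interval, and it does so
    from its last lam' l cells on. *)
Lemma bot_case : e = Bot ->
  `[x 0%N, x N[%classic `&` gmap F @^-1` gint F Top l =
  cell (offs pi Top lam w + lam' w) (lam' l).
Proof.
move=> eB; have [gintF car] := realF; have ow := offs_w; have ol := offs_l.
move: (ow) (ol); rewrite gintF eB /= => ow' ol'; rewrite predeqE => s; split.
  move=> []; rewrite /= in_itv /= => sN; rewrite ol' => /cellP/andP[fs1 fs2].
  have [y ys] := cells_cover pi Top sN.
  have yw : y = w.
    apply/eqP; apply: contraTT fs1 => yw; rewrite -ltNge.
    have /cellP/andP[_ fs] := carries_cell (car y) ys.
    apply: lt_le_trans fs _; rewrite x_mono.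
    move: w_last; rewrite eB => /last_before/(_ yw)/leq_trans; apply.
    by rewrite -ow' leq_addr.
  subst y; have /cellP/andP[s1 s2] := ys.
  apply/cellP; rewrite -addnA -lam_w s2 andbT leNgt; apply/negP => s3.
  have := carries_sub (i := 0) (m := lam' w) _ (car w); rewrite !addn0.
  move=> /(_ (leq_trans (leq_addr _ _) (eq_leq (esym lam_w)))) cw.
  have /(carries_cell cw)/cellP/andP[_] : cell (offs pi Top lam w) (lam' w) s.
    by apply/cellP; rewrite s1.
  by rewrite ow' ltNge fs1.
move=> ws; split.
  have := offs_total pi Top lam w; rewrite lam_w addnA => le_N.
  move/cellP: ws => /andP[s1 s2]; rewrite /= in_itv /= (le_trans _ s1) ?x_mono //.
  by apply: lt_le_trans s2 _; rewrite x_mono.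
have := carries_cell (carries_sub (eq_leq (esym lam_w)) (car w)) ws.
by rewrite ow' /= ol' lam_l.
Qed.

Lemma induced_top y : gint F' Top y = cell (offs pi' Top lam' y) (lam' y).
Proof.
have [gintF car] := realF.
have oW := offs_winner w_last lamE; have oL := offs_loser w_last l_last wl lamE.
have other z : z != w -> z != l ->
    gint F Top z = cell (offs pi' Top lam' z) (lam' z).
  by move=> zw zl; rewrite gintF offs_other // lam_other.
move: top_case bot_case oW oL; rewrite /F' /= -/pi' /at_ /ab.
case eE: (e) => /= topP botP oW oL.
  case: eqP => [->|/eqP yw]; first by rewrite topP // oW.
  by rewrite gintF lam_other // oW.
rewrite botP //; case: eqP => [->|/eqP yl]; first by rewrite oL.
case: eqP => [->|/eqP yw]; last exact: other.
rewrite gintF offs_other //; rewrite predeqE => s; split.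
  move=> [/cellP/andP[s1 s2] ns]; apply/cellP; rewrite s1 ltNge /=.
  by apply/negP => s3; apply/ns/cellP; rewrite s3 -addnA -lam_w.
move=> /cellP/andP[s1 s2]; split.
  by apply/cellP; rewrite s1 (lt_le_trans s2) // x_mono leq_add2l lam_w leq_addr.
by move=> /cellP/andP[s3 _]; move: s2; rewrite ltNge s3.
Qed.

(** Points of the branches other than l return at time 1, those of l at time 2,
    by way of the removed interval. *)
Lemma realizes_step : realizes pi' lam' F'.
Proof.
have [gintF car] := realF.
have carF y : carries (gmap F') (offs pi' Top lam' y) (offs pi' Bot lam' y) (lam' y).
  have [->|yl] := eqVneq y l.
    have [c1 c2] := carries_l1; apply: carries_ext (carries_comp c1 c2) => s ls.
    apply: first_return2.
      have /cellP/andP[s1 _] := carries_cell c1 ls.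
      by rewrite /= in_itv /= => /andP[_]; rewrite ltNge s1.
    apply: cell_below (carries_cell c2 (carries_cell c1 ls)).
    exact: offs_total.
  rewrite !(offs_other _ yl).
  have := carries_sub (i := 0) (m := lam' y) _ (car y); rewrite !addn0 => cary0.
  have cary := cary0 (leq_trans (leq_addr _ _) (eq_leq (esym (lamE y)))).
  apply: (carries_ext _ cary) => s ys; apply: first_return1.
  by apply: cell_below (carries_cell cary ys); apply: other_below.
split=> // -[] y; first exact: induced_top.
have [<- _ _] := carF y; rewrite -induced_top //.
Qed.

End Step.

Lemma realizes_path (C : {set datum T}) pi (s : seq (arrow T)) (F : pregiet R T) :
  (1 < #|T|)%N -> {in C, forall pi, admissible pi} -> compatible C pi s ->
  realizes pi (lengths s) F ->
  induction_arrows pi (x 0%N) (x (\sum_y lengths s y)%N) F (size s) = Some s.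
Proof.
move=> T1 Cadm; elim: s pi F => [|[pi1 e] s IHs] pi F //=.
move=> [-> piC compat] realF.
have [w [l [wL lL wl lamE]]] := path_step e s T1 Cadm piC.
have sgt0 := @lengths_gt0 _ s.
have [ne sideE] := crit_side wL lL wl lamE sgt0 realF.
rewrite (at_last wL lL) (ab_last wL lL) ne sideE (crit_max wL lL wl lamE sgt0 realF).
by rewrite (IHs _ _ compat (realizes_step wL lL wl lamE realF)).
Qed.

End OneAlphabet.
End Dynamics.

(** * Continuity on the closed simplex *)
Section ContOn.
Local Open Scope classical_set_scope.
Local Open Scope ring_scope.
Variables (R : realType) (K : finType) (X : set (K -> R)).
Implicit Types h : (K -> R) -> R.

Lemma cont_on_coord k : cont_on X (fun g => g k).
Proof. by move=> g _ e e0; exists e => // g' _; apply. Qed.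

Lemma cont_on_cst c : cont_on X (fun=> c).
Proof. by move=> g _ e e0; exists e => // g' _ _; rewrite subrr normr0. Qed.

Lemma cont_onB h1 h2 : cont_on X h1 -> cont_on X h2 -> cont_on X (fun g => h1 g - h2 g).
Proof.
move=> c1 c2 g Xg e e0; have e2 : 0 < e / 2 by rewrite divr_gt0.
have [d1 d10 P1] := c1 g Xg _ e2; have [d2 d20 P2] := c2 g Xg _ e2.
exists (Num.min d1 d2) => [|g' Xg' gg']; first by rewrite lt_min d10.
have /ltr_normlP[a1 a2] : `|h1 g - h1 g'| < e / 2.
  by apply: P1 => // k; apply: lt_le_trans (gg' k) _; rewrite ge_min lexx.
have /ltr_normlP[b1 b2] : `|h2 g - h2 g'| < e / 2.
  by apply: P2 => // k; apply: lt_le_trans (gg' k) _; rewrite ge_min lexx orbT.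
by apply/ltr_normlP; split; lra.
Qed.

Lemma cont_onD h1 h2 : cont_on X h1 -> cont_on X h2 -> cont_on X (fun g => h1 g + h2 g).
Proof.
move=> c1 c2; have := cont_onB c1 (cont_onB (cont_on_cst 0) c2).
by move=> c g Xg e e0; have [d d0 P] := c g Xg e e0; exists d => // g' Xg' gg';
  have := P g' Xg' gg'; rewrite !sub0r !opprK.
Qed.

Lemma cont_on_sum (J : finType) (P : pred J) (h : J -> (K -> R) -> R) :
  (forall j, cont_on X (h j)) -> cont_on X (fun g => \sum_(j | P j) h j g).
Proof.
move=> ch; elim: (index_enum J) => [|j s IHs].
  move=> g Xg e e0; exists e => // g' _ _; rewrite !big_nil subrr normr0 //.
case Pj: (P j); have := cont_onD (ch j) IHs => // c; [|move: c IHs => _ c];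
  by move=> g Xg e e0; have [d d0 Q] := c g Xg e e0; exists d => // g' Xg' gg';
    have := Q g' Xg' gg'; rewrite !big_cons Pj.
Qed.

End ContOn.

Section Density.
Local Open Scope classical_set_scope.
Local Open Scope ring_scope.
Variables (R : realType) (K : finType).
Local Notation closed_simplex := (@closed_simplex R K).
Local Notation simplex := (@simplex R K).

Lemma simplex_closed t : simplex t -> closed_simplex t.
Proof. by move=> [t0 t1]; split=> // k; apply/ltW. Qed.

Lemma simplex_dense t (d : R) : closed_simplex t -> 0 < d ->
  exists2 t', simplex t' & forall k, `|t k - t' k| < d.
Proof.
move=> ts d0; have [t0 t1] := ts.
have K0 : (0 < #|K|)%N.
  rewrite lt0n; apply/eqP => /card0_eq K0; move: t1; rewrite big_pred0 //.
  by move/eqP; rewrite eq_sym oner_eq0.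
have KR0 : 0 < #|K|%:R :> R by rewrite ltr0n.
pose s := Num.min (d / 2) (2^-1).
have s0 : 0 < s by rewrite lt_min divr_gt0 //= invr_gt0.
have s1 : s <= 2^-1 by rewrite ge_min lexx orbT.
have sd : s <= d / 2 by rewrite ge_min lexx.
have s1' : s < 1 by lra.
exists (fun k => (1 - s) * t k + s / #|K|%:R) => [|k].
  split=> [k|].
    by apply: ltr_wpDl; [apply: mulr_ge0 => //; lra | rewrite divr_gt0].
  rewrite big_split /= -mulr_sumr t1 sumr_const -(mulr_natr (s / #|K|%:R)).
  rewrite divfK ?gt_eqF //.
  by lra.
have -> : t k - ((1 - s) * t k + s / #|K|%:R) = s * (t k - #|K|%:R^-1).
  by field; rewrite gt_eqF.
have K1 : 0 < (#|K|%:R^-1 : R) <= 1 by rewrite invr_gt0 KR0 invf_le1 // ler1n.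
have /andP[tk0 tk1] := simplex_le1 k ts; move: K1 => /andP[K1 K2].
have tkK : `|t k - #|K|%:R^-1| <= 1 by rewrite ler_norml; apply/andP; split; lra.
by rewrite normrM gtr0_norm //; have := ler_pM (ltW s0) (normr_ge0 _) (lexx s) tkK; lra.
Qed.

(** Extends to degenerations the identities known for GIETs. *)
Lemma cont_on_zero (h : (K -> R) -> R) : cont_on closed_simplex h ->
  (forall t, simplex t -> h t = 0) -> forall t, closed_simplex t -> h t = 0.
Proof.
move=> ch h0 t ts; apply/eqP; rewrite -normr_eq0 eq_le normr_ge0 andbT.
apply/ler_addgt0Pl => e e0; rewrite addr0; have [d d0 hd] := ch t ts e e0.
have [t' t's tt'] := simplex_dense ts d0.
by have := hd t' (simplex_closed t's) tt'; rewrite (h0 t') // subr0 => /ltW.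
Qed.

End Density.

(** * Closed graphs of branches *)
Section Curves.
Local Open Scope classical_set_scope.
Local Open Scope ring_scope.
Variable R : realType.
Implicit Types (P Q : set (R * R)) (z m M : R * R).

(** What the closed graph of a branch has in common with the point to which it
    may degenerate: m and M are its lower left and upper right corners, its
    projections are segments, and it is strictly monotone in both directions. *)
Record curve P m M : Prop := Curve {
  curve_min : P m;
  curve_max : P M;
  curve_box : forall z, P z -> (m.1 <= z.1 <= M.1) /\ (m.2 <= z.2 <= M.2);
  curve_mono : forall z w, P z -> P w -> (z.1 < w.1) = (z.2 < w.2);
  curve_fst : forall a, m.1 <= a <= M.1 -> exists2 z, P z & z.1 = a;
  curve_snd : forall a, m.2 <= a <= M.2 -> exists2 z, P z & z.2 = a }.

Lemma curve_point z : curve [set z] z z.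
Proof.
split=> //; first by move=> _ ->; rewrite !lexx.
- by move=> _ _ -> ->; rewrite !ltxx.
- by move=> a /le_anti <-; exists z.
- by move=> a /le_anti <-; exists z.
Qed.

Lemma curve_snd_inj P m M z w : curve P m M -> P z -> P w -> z.2 = w.2 -> z.1 = w.1.
Proof.
move=> c Pz Pw e; apply/eqP; rewrite eq_le !leNgt.
by rewrite (curve_mono c Pz Pw) (curve_mono c Pw Pz) e ltxx.
Qed.

Definition swap_pair z : R * R := (z.2, z.1).

Lemma closureP P z : closure P z <->
  (forall e : R, 0 < e -> exists2 w, P w & `|z.1 - w.1| < e /\ `|z.2 - w.2| < e).
Proof.
split=> [cP e e0|cP B /nbhs_ballP[e /= e0 eB]].
  by have [w [Pw [w1 w2]]] := cP _ (nbhsx_ballx z e e0); exists w.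
by have [w Pw [w1 w2]] := cP e e0; exists w; split=> //; apply: eB.
Qed.

Lemma closure_swap P z : closure P z -> closure [set w | P (swap_pair w)] (swap_pair z).
Proof.
move=> /closureP cz; apply/closureP => e e0; have [w Pw [w1 w2]] := cz e e0.
by exists (swap_pair w) => //=; rewrite /swap_pair -surjective_pairing.
Qed.

(** Two points p, q of P whose abscissas cut the gap from z to w in three
    separate the ordinates of points of P near z from those of points near w. *)
Lemma closure_lt P z w : (forall p q, P p -> P q -> p.1 < q.1 -> p.2 < q.2) ->
  (forall a, z.1 < a < w.1 -> exists2 p, P p & p.1 = a) ->
  closure P z -> closure P w -> z.1 < w.1 -> z.2 < w.2.
Proof.
move=> mono fill /closureP cz /closureP cw zw.
pose e1 := (w.1 - z.1) / 3.
have [|p Pp p1] := fill (z.1 + e1); first by rewrite /e1; apply/andP; split; lra.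
have [|q Pq q1] := fill (w.1 - e1); first by rewrite /e1; apply/andP; split; lra.
have e10 : 0 < e1 by rewrite divr_gt0 // subr_gt0.
have zp : z.2 <= p.2.
  apply/ler_addgt0Pr => e e0.
  have [|z' Pz' []] := cz (Num.min e e1); first by rewrite lt_min e0.
  rewrite !lt_min => /andP[_ /ltr_normlP[a1 a2]] /andP[/ltr_normlP[b1 b2] _].
  have : z'.2 < p.2 by apply: mono => //; lra.
  lra.
have qw : q.2 <= w.2.
  apply/ler_addgt0Pr => e e0.
  have [|w' Pw' []] := cw (Num.min e e1); first by rewrite lt_min e0.
  rewrite !lt_min => /andP[_ /ltr_normlP[a1 a2]] /andP[/ltr_normlP[b1 b2] _].
  have : q.2 < w'.2 by apply: mono => //; lra.
  lra.
have : p.2 < q.2 by apply: mono => //; rewrite p1 q1 /e1; lra.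
lra.
Qed.

(** Strict monotonicity survives the closure in both directions because the
    branch is onto an interval: apply [closure_lt] to the graph and to its
    mirror image. *)
Lemma curve_closed_graph (f : R -> R) (u v u' v' : R) : u < v -> u' < v' ->
  set_bij `[u, v[ `[u', v'[ f -> {in `[u, v[ &, {homo f : s t / s < t}} ->
  curve (closure [set z | `[u, v[%classic z.1 /\ z.2 = f z.1]) (u, u') (v, v').
Proof.
move=> uv uv' [fim _ fsur] fhom; set G := [set z | _].
have inG s : u <= s < v -> G (s, f s) by move=> us; split=> //=; rewrite in_itv.
have subG z : G z -> closure G z by exact: subset_closure.
have fI s : u <= s < v -> u' <= f s < v'.
  by move=> us; have := fim s; rewrite /= !in_itv /= => /(_ us).
have fS t : u' <= t < v' -> exists2 s, u <= s < v & f s = t.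
  by move=> ut; have [|s] := fsur t; rewrite /= in_itv /= // => us <-; exists s.
have mono s t : u <= s < v -> u <= t < v -> (f s < f t) = (s < t).
  move=> us ut; apply/idP/idP => [|st]; last by apply: fhom; rewrite ?in_itv.
  apply: contraTT; rewrite -!leNgt le_eqVlt => /orP[/eqP -> //|ts].
  by apply/ltW; apply: fhom; rewrite ?in_itv.
have fu : f u = u'.
  have [|s us fs] := fS u'; first by rewrite lexx.
  have uu : u <= u < v by rewrite lexx.
  have /andP[le_u _] := fI u uu; apply/eqP; rewrite eq_le le_u andbT.
  rewrite -fs leNgt mono // -leNgt; by case/andP: us.
have box z : closure G z -> (u <= z.1 <= v) /\ (u' <= z.2 <= v').
  move=> /closureP cz; split; apply/andP; split; apply/ler_addgt0Pr => e e0;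
  have [w [+ w2] [z1 z2]] := cz e e0;
  rewrite /= in_itv /= => /[dup] /andP[a1 a2] /fI/andP;
  rewrite -w2 => -[b1 b2]; move: z1 z2 => /ltr_normlP[c1 c2] /ltr_normlP[d1 d2]; lra.
have corner : closure G (v, v').
  apply/closureP => e e0 /=.
  pose p := Num.max u' (v' - e / 2).
  have [|s0 us0 fs0] := fS p.
    by rewrite le_max lexx /= gt_max uv' /=; lra.
  pose s := Num.max s0 (v - e / 2).
  have /andP[us1 us2] := us0.
  have s0s : s0 <= s by rewrite le_max lexx.
  have vs : v - e / 2 <= s by rewrite le_max lexx orbT.
  have us : u <= s < v.
    by rewrite (le_trans us1) //= gt_max us2 /=; lra.
  have le_p : p <= f s by rewrite -fs0 leNgt mono // -leNgt.
  have vp : v' - e / 2 <= p by rewrite le_max lexx orbT.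
  have /andP[fs1 fs2] := fI s us; have /andP[_ sv] := us.
  exists (s, f s) => /=; first exact: inG.
  by rewrite !ger0_norm; lra.
split=> //=.
- by apply/subG; rewrite -fu; apply: inG; rewrite lexx.
- move=> z w cz cw; have [/andP[z1 z2] /andP[z3 z4]] := box _ cz.
  have [/andP[w1 w2] /andP[w3 w4]] := box _ cw.
  apply/idP/idP.
    apply: closure_lt cz cw => [p q [/= + ->] [/= + ->]|a /andP[za aw]].
      by rewrite !in_itv /= => up uq; rewrite mono.
    by exists (a, f a) => //; apply: inG; apply/andP; split; lra.
  apply: (@closure_lt [set z | G (swap_pair z)] (swap_pair z) (swap_pair w)) => //=.
  + move=> p q [/= + ->] [/= + ->].
    by rewrite !in_itv /= => up uq; rewrite mono.
  + move=> a /andP[za aw]; have [|s us fs] := fS a; first by apply/andP; split; lra.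
    by exists (a, s) => //=; rewrite -fs; apply: inG.
  + exact: closure_swap.
  + exact: closure_swap.
- move=> a /andP[ua]; rewrite le_eqVlt => /orP[/eqP ->|av]; first by exists (v, v').
  by exists (a, f a) => //; apply/subG/inG; rewrite ua.
- move=> a /andP[ua]; rewrite le_eqVlt => /orP[/eqP ->|av]; first by exists (v, v').
  have [|s us fs] := fS a; first by rewrite ua.
  by exists (s, f s) => //; apply/subG/inG.
Qed.

(** Two points of P with abscissas just beside that of z, or the ends of P,
    confine the points whose ordinates are close to that of z. *)
Lemma curve_inverse P m M z (e : R) : curve P m M -> P z -> 0 < e ->
  exists2 d : R, 0 < d & forall w, P w -> `|z.2 - w.2| < d -> `|z.1 - w.1| < e.
Proof.
move=> c Pz e0; have [/andP[z1 z2] _] := curve_box c Pz.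
have [d1 d10 D1] : exists2 d : R, 0 < d &
    forall w, P w -> w.2 < z.2 + d -> w.1 < z.1 + e.
  have [Mz|zM] := leP M.1 z.1.
    by exists 1 => // w /(curve_box c)[/andP[_ w1] _] _; lra.
  have [|p Pp p1] := curve_fst c (a := Num.min M.1 (z.1 + e / 2)).
    by rewrite ge_min lexx le_min (le_trans z1 z2) /= andbT; lra.
  have zp : z.1 < p.1 by rewrite p1 lt_min zM; lra.
  exists (p.2 - z.2) => [|w Pw]; first by rewrite subr_gt0 -(curve_mono c).
  rewrite addrC subrK -(curve_mono c) // => wp.
  have : p.1 <= z.1 + e / 2 by rewrite p1 ge_min lexx orbT.
  lra.
have [d2 d20 D2] : exists2 d : R, 0 < d &
    forall w, P w -> z.2 - d < w.2 -> z.1 - e < w.1.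
  have [zm|mz] := leP z.1 m.1.
    by exists 1 => // w /(curve_box c)[/andP[w1 _] _] _; lra.
  have [|p Pp p1] := curve_fst c (a := Num.max m.1 (z.1 - e / 2)).
    by rewrite le_max lexx ge_max (le_trans z1 z2) /=; lra.
  have zp : p.1 < z.1 by rewrite p1 gt_max mz; lra.
  exists (z.2 - p.2) => [|w Pw]; first by rewrite subr_gt0 -(curve_mono c).
  rewrite opprB addrC subrK -(curve_mono c) // => wp.
  have : z.1 - e / 2 <= p.1 by rewrite p1 le_max lexx orbT.
  lra.
exists (Num.min d1 d2) => [|w Pw]; first by rewrite lt_min d10.
rewrite lt_min => /andP[/ltr_normlP[a1 a2] /ltr_normlP[b1 b2]].
have := D1 w Pw; have := D2 w Pw => l1 l2.
have {}l1 : z.1 - e < w.1 by apply: l1; lra.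
have {}l2 : w.1 < z.1 + e by apply: l2; lra.
by apply/ltr_normlP; split; lra.
Qed.

Definition near_sets (e : R) P Q : Prop :=
  forall z, P z -> exists2 w, Q w & `|z.1 - w.1| < e /\ `|z.2 - w.2| < e.

Lemma near_corners e P Q m M m' M' : curve P m M -> curve Q m' M' ->
  near_sets e P Q ->
  [/\ m'.1 < m.1 + e, m'.2 < m.2 + e, M.1 < M'.1 + e & M.2 < M'.2 + e].
Proof.
move=> cP cQ near.
have [w Qw [/ltr_normlP[a1 a2] /ltr_normlP[a3 a4]]] := near m (curve_min cP).
have [w' Qw' [/ltr_normlP[b1 b2] /ltr_normlP[b3 b4]]] := near M (curve_max cP).
have [/andP[c1 c2] /andP[c3 c4]] := curve_box cQ Qw.
have [/andP[d1 d2] /andP[d3 d4]] := curve_box cQ Qw'.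
by split; lra.
Qed.

Definition in_box P : Prop := forall z, P z -> (0 <= z.1 <= 1) /\ (0 <= z.2 <= 1).

Lemma dist_bounds z w : [/\ 0 <= euclidean_dist z w,
  `|z.1 - w.1| <= euclidean_dist z w & `|z.2 - w.2| <= euclidean_dist z w].
Proof.
rewrite /euclidean_dist; split; first exact: sqrtr_ge0.
  by rewrite -sqrtr_sqr ler_wsqrtr // lerDl sqr_ge0.
by rewrite -sqrtr_sqr ler_wsqrtr // lerDr sqr_ge0.
Qed.

Lemma dist_le2 z w : (0 <= z.1 <= 1) /\ (0 <= z.2 <= 1) ->
  (0 <= w.1 <= 1) /\ (0 <= w.2 <= 1) -> euclidean_dist z w <= 2.
Proof.
move=> [/andP[z1 z2] /andP[z3 z4]] [/andP[w1 w2] /andP[w3 w4]].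
rewrite -[leRHS]ger0_norm // -sqrtr_sqr ler_wsqrtr //.
have sq (a : R) : -1 <= a -> a <= 1 -> a ^+ 2 <= 1 by move=> *; nra.
have := sq (z.1 - w.1); have := sq (z.2 - w.2); lra.
Qed.

Lemma dist_sym z w : euclidean_dist z w = euclidean_dist w z.
Proof. by rewrite /euclidean_dist -(sqrrN (z.1 - w.1)) -(sqrrN (z.2 - w.2)) !opprB. Qed.

Lemma sup_inf_dist P Q : P !=set0 -> Q !=set0 -> in_box P -> in_box Q ->
  let h := sup [set inf [set euclidean_dist z w | w in Q] | z in P] in
  0 <= h /\ forall e, h < e -> near_sets e P Q.
Proof.
move=> [z0 Pz0] [w0 Qw0] bP bQ h.
have infP z : P z -> 0 <= inf [set euclidean_dist z w | w in Q] <= 2.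
  move=> Pz; apply/andP; split.
    apply: lb_le_inf; first by exists (euclidean_dist z w0), w0.
    by move=> _ [w _ <-]; have [] := dist_bounds z w.
  apply: le_trans (dist_le2 (bP z Pz) (bQ w0 Qw0)).
  apply: ge_inf; last by exists w0.
  by exists 0 => _ [w _ <-]; have [] := dist_bounds z w.
have ub : has_ubound [set inf [set euclidean_dist z w | w in Q] | z in P].
  by exists 2 => _ [z /infP/andP[_ ?] <-].
have le_h z : P z -> inf [set euclidean_dist z w | w in Q] <= h.
  by move=> Pz; apply: ub_le_sup => //; exists z.
split=> [|e he z Pz].
  by apply: le_trans (le_h z0 Pz0); have /andP[] := infP _ Pz0.
have [||_ [w Qw <-] lt_e] := @inf_lt _ [set euclidean_dist z w | w in Q] e.
- by exists (euclidean_dist z w0), w0.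
- exact: le_lt_trans (le_h z Pz) he.
have [_ d1 d2] := dist_bounds z w.
by exists w => //; split; apply: le_lt_trans lt_e.
Qed.

Lemma hausdorff_near P Q : P !=set0 -> Q !=set0 -> in_box P -> in_box Q ->
  0 <= hausdorff_dist P Q /\
  forall e, hausdorff_dist P Q < e -> near_sets e P Q /\ near_sets e Q P.
Proof.
move=> P0 Q0 bP bQ; have [h1 n1] := sup_inf_dist P0 Q0 bP bQ.
have [h2 n2] := sup_inf_dist Q0 P0 bQ bP.
have E : [set inf [set euclidean_dist z w | z in P] | w in Q] =
         [set inf [set euclidean_dist z w | w in P] | z in Q].
  apply: eq_imagel => w _; congr inf; apply: eq_imagel => z _; exact: dist_sym.
rewrite /hausdorff_dist E; split=> [|e]; first by rewrite le_max h1.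
by rewrite gt_max => /andP[/n1 ? /n2 ?].
Qed.

End Curves.

(** * Pieces of GIETs and of their degenerations *)
Section Pieces.
Local Open Scope classical_set_scope.
Local Open Scope ring_scope.
Variable R : realType.

(** By induction on k, the intervals in the first k positions fill [[a, E k[]:
    if the next interval started before [E k] it would meet one of them; if it
    started after, the point [E k] would lie in a later interval, hence to the
    right of it. *)
Lemma partition_ends (T : finType) (pi : datum T) (e : side) (a b : R)
    (I : T -> set R) : a < b ->
  (forall x, right_open (I x)) -> trivIset setT I ->
  \bigcup_x I x = `[a, b[%classic ->
  (forall x y, (pos pi e x < pos pi e y)%N ->
     forall s t, I x s -> I y t -> s < t) ->
  exists lo hi : T -> R,
    [/\ forall x, lo x < hi x /\ I x = `[lo x, hi x[%classic,
        forall x, lo x = a + \sum_(y | (pos pi e y < pos pi e x)%N) (hi y - lo y) &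
        \sum_y (hi y - lo y) = b - a].
Proof.
move=> ab /choice[lo /choice[hi loI]] tI cov ord.
have lohi x : lo x < hi x by have [] := loI x.
have IE x s : I x s <-> lo x <= s < hi x.
  by have [_ ->] := loI x; rewrite /= in_itv.
have covP s : (exists x, I x s) <-> a <= s < b.
  have -> : (exists x, I x s) <-> (\bigcup_x I x) s.
    by split=> [[x xs]|[x _ xs]]; exists x.
  by rewrite cov /= in_itv.
have disj x y s : I x s -> I y s -> x = y by move=> xs ys; apply: tI => //; exists s.
exists lo, hi; pose E k := a + \sum_(y | (pos pi e y < k)%N) (hi y - lo y).
have aE k : a <= E k.
  by rewrite lerDl; apply: sumr_ge0 => y _; rewrite subr_ge0 ltW.
have loin x : I x (lo x) by rewrite IE lexx lohi.
have step k : (k <= #|T|)%N ->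
    (forall x, (pos pi e x < k)%N -> lo x = E (pos pi e x)) /\
    forall s, (a <= s < E k) <-> exists2 x, (pos pi e x < k)%N & I x s.
  elim: k => [_|k IHk kT].
    split=> // s; rewrite /E big_pred0 // addr0; split=> [/andP[]|[]//].
    by move=> /le_lt_trans h/h; rewrite ltxx.
  have [IHlo IHI] := IHk (ltnW kT).
  pose al := letter pi e (Ordinal kT).
  have pal : pos pi e al = k :> nat by rewrite letterK.
  have eq_al y : pos pi e y = k :> nat -> y = al.
    by rewrite -pal => /val_inj/(@pos_inj _ pi e).
  have loE : lo al = E k.
    apply/eqP; rewrite eq_le !leNgt; apply/andP; split; apply/negP => lt_lo.
      have /covP[y yE] : a <= E k < b.
        rewrite aE (lt_trans lt_lo) //.
        by have /covP/andP[] : exists x, I x (lo al) by exists al.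
      case: (ltngtP (pos pi e y) k) => [yk|ky|/eq_al yal].
      - by have /IHI : exists2 x, (pos pi e x < k)%N & I x (E k) by [exists y];
          rewrite ltxx andbF.
      - by have := ord al y; rewrite pal => /(_ ky _ _ (loin al) yE); rewrite ltNge ltW.
      - by move: yE; rewrite yal IE leNgt lt_lo.
    have [y yk yI] : exists2 x, (pos pi e x < k)%N & I x (lo al).
      apply/IHI; rewrite lt_lo andbT.
      by have /covP/andP[] : exists x, I x (lo al) by exists al.
    by move: yk; rewrite (disj _ _ _ yI (loin al)) pal ltnn.
  have ES : E k.+1 = hi al.
    rewrite /E (bigD1 al) ?pal ?ltnSn //= addrCA -[X in _ + X]/(a + _).
    rewrite (eq_bigl (fun y => (pos pi e y < k)%N)).
      by rewrite -/(E k) -loE subrK.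
    move=> y; rewrite ltnS [RHS]ltn_neqAle andbC; congr (~~ _ && _).
    by apply/eqP/eqP => [->|/eq_al].
  split=> [x|s].
    rewrite ltnS leq_eqVlt => /orP[/eqP xk|/IHlo //].
    by rewrite xk (eq_al _ xk).
  rewrite ES; split=> [/andP[s1 s2]|[x]].
    have [sE|sE] := ltP s (E k).
      have [|x xk xs] := (IHI s).1; first by rewrite s1.
      by exists x => //; apply: ltnW.
    by exists al; [rewrite pal | rewrite IE loE sE].
  rewrite ltnS leq_eqVlt => /orP[/eqP/eq_al ->|xk xs].
    by rewrite IE loE => /andP[s1 ->]; rewrite (le_trans _ s1).
  have [|s1 s2] := andP ((IHI s).2 _); first by exists x.
  by rewrite s1 (lt_trans s2) // -loE.
have [_ HT] := step #|T| (leqnn _); split.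
- by move=> x; split=> //; have [] := loI x.
- by move=> x; have [+ _] := step #|T| (leqnn _); apply; apply: ltn_ord.
have ET : E #|T| = b.
  apply/eqP; rewrite eq_le !leNgt; apply/andP; split; apply/negP => ltb.
    have /HT[x _ xb] : a <= b < E #|T| by rewrite (ltW ab).
    by have /covP : exists x, I x b by [exists x]; rewrite ltxx andbF.
  have /covP[x xE] : a <= E #|T| < b by rewrite aE.
  have /HT : exists2 x, (pos pi e x < #|T|)%N & I x (E #|T|) by exists x.
  by rewrite ltxx andbF.
rewrite -ET /E addrC addKr; apply: eq_bigl => y; rewrite ltn_ord //.
Qed.

Lemma giet_curve (T : finType) (pi : datum T) (a b : R) (f : pregiet R T) :
  giet pi a b f -> exists lo hi : side -> T -> R,
  [/\ forall e x, lo e x < hi e x /\ gint f e x = `[lo e x, hi e x[%classic,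
      forall e x, lo e x = a + \sum_(y | (pos pi e y < pos pi e x)%N) (hi e y - lo e y),
      forall e, \sum_y (hi e y - lo e y) = b - a,
      forall e x, a <= lo e x /\ hi e x <= b &
      forall x, curve (closed_graph f x) (lo Top x, lo Bot x) (hi Top x, hi Bot x)].
Proof.
move=> [ab _ part hom].
have /choice[lo /choice[hi ends]] : forall e, exists lo hi : T -> R,
    [/\ forall x, lo x < hi x /\ gint f e x = `[lo x, hi x[%classic,
        forall x, lo x = a + \sum_(y | (pos pi e y < pos pi e x)%N) (hi y - lo y) &
        \sum_y (hi y - lo y) = b - a].
  by move=> e; have [] := part e; apply: partition_ends.
exists lo, hi; split.
- by move=> e; have [] := ends e.
- by move=> e; have [] := ends e.
- by move=> e; have [] := ends e.
- move=> e x; have [/(_ x)[lt_x Ix] _ _] := ends e; have [_ _ cov _] := part e.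
  have sub s : lo e x <= s < hi e x -> a <= s < b.
    move=> xs; have : (\bigcup_x gint f e x) s.
      by exists x => //; rewrite Ix /= in_itv.
    by rewrite cov /= in_itv.
  split; first by have /andP[] : a <= lo e x < b by apply: sub; rewrite lexx.
  rewrite leNgt; apply/negP => bh.
  have /andP[_] : a <= Num.max (lo e x) b < b.
    by apply: sub; rewrite le_max lexx gt_max lt_x.
  by rewrite ltNge le_max lexx orbT.
move=> x; have [bij mono _ _] := hom x.
have [/(_ x)[ltT IT] _ _] := ends Top; have [/(_ x)[ltB IB] _ _] := ends Bot.
rewrite /closed_graph IT; apply: curve_closed_graph => //; first by rewrite -IT -IB.
by move=> s t sI tI; apply: mono; rewrite IT inE.
Qed.

Lemma ghat_curve (T : finType) (pi : datum T) (D : preghat R T) (x : T) :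
  ghat pi 0 1 D -> exists m M, curve (piece D x) m M /\ in_box (piece D x).
Proof.
have box P (m M : R * R) : curve P m M ->
    0 <= m.1 -> 0 <= m.2 -> M.1 <= 1 -> M.2 <= 1 -> in_box P.
  move=> c m1 m2 M1 M2 z /(curve_box c)[/andP[z1 z2] /andP[z3 z4]].
  by split; apply/andP; split; lra.
case: D => [f|D] /=.
  move=> /giet_curve[lo [hi [_ _ _ bd cv]]].
  exists (lo Top x, lo Bot x), (hi Top x, hi Bot x); split=> //.
  by have [? ?] := bd Top x; have [? ?] := bd Bot x; apply: box (cv x) _ _ _ _.
move=> [_ /giet_curve[lo [hi [I _ _ bd cv]]] sing].
case: insubP => [y _ _|xD].
  exists (lo Top y, lo Bot y), (hi Top y, hi Bot y); split=> //.
  by have [? ?] := bd Top y; have [? ?] := bd Bot y; apply: box (cv y) _ _ _ _.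
exists (dsingular D x), (dsingular D x); split; first exact: curve_point.
have crit01 e y : 0 <= crit (dregular D) e y <= 1.
  have [lt_y Iy] := I e y; have [? ?] := bd e y.
  by rewrite /crit Iy inf_itvco //; apply/andP; split; lra.
move=> _ ->; have [s1 s2] := sing x xD; split.
  by case: s1 => [[y ->]|->]; rewrite ?crit01 ?ler01 ?lexx.
by case: s2 => [[y ->]|->]; rewrite ?crit01 ?ler01 ?lexx.
Qed.

Lemma curve_corners_uniq P (m M m' M' : R * R) :
  curve P m M -> curve P m' M' -> m = m' /\ M = M'.
Proof.
move=> c c'.
have [/andP[a1 a2] /andP[a3 a4]] := curve_box c (curve_min c').
have [/andP[b1 b2] /andP[b3 b4]] := curve_box c (curve_max c').
have [/andP[d1 d2] /andP[d3 d4]] := curve_box c' (curve_min c).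
have [/andP[e1 e2] /andP[e3 e4]] := curve_box c' (curve_max c).
split; [rewrite (surjective_pairing m) (surjective_pairing m') |
        rewrite (surjective_pairing M) (surjective_pairing M')];
  by congr (_, _); apply: le_anti; apply/andP; split.
Qed.

Section Family.
Variables (T : finType) (pi : datum T) (F : (T -> R) -> pregiet R T).
Hypothesis full : full_family pi F.
Local Notation closed_simplex := (@closed_simplex R T).
Local Notation simplex := (@simplex R T).

(** [P t x] is the piece of label x of the extended family at t, with corners
    [m t x] and [M t x]; closeness for [Dist] is only used as mutual closeness
    of these sets. *)
Lemma full_family_curves : exists P : (T -> R) -> T -> set (R * R),
  exists m M : (T -> R) -> T -> R * R,
  [/\ forall t x, closed_simplex t -> curve (P t x) (m t x) (M t x),
      forall t, closed_simplex t -> forall e : R, 0 < e -> exists2 d : R, 0 < d &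
        forall t', closed_simplex t' -> (forall x, `|t x - t' x| < d) ->
        forall x, near_sets e (P t x) (P t' x) /\ near_sets e (P t' x) (P t x) &
      forall t x, simplex t -> P t x = closed_graph (F t) x].
Proof.
have [_ _ _ [Fhat [ghatF regF contF]]] := full.
pose P t x := piece (Fhat t) x.
have /choice[mM mMP] : forall tx : (T -> R) * T, exists mM : (R * R) * (R * R),
    closed_simplex tx.1 -> curve (P tx.1 tx.2) mM.1 mM.2.
  move=> [t x] /=; have [ts|nts] := pselect (closed_simplex t); last by exists (0, 0).
  by have [m [M [c _]]] := ghat_curve x (ghatF t ts); exists (m, M).
exists P, (fun t x => (mM (t, x)).1), (fun t x => (mM (t, x)).2); split.
- by move=> t x ts; exact: (mMP (t, x)).
- move=> t ts e e0; have [d d0 dP] := contF t ts e e0.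
  exists d => // t' t's tt' x; have lt_e := dP t' t's tt'.
  have near y : 0 <= hausdorff_dist (P t y) (P t' y) /\
      forall e, hausdorff_dist (P t y) (P t' y) < e ->
        near_sets e (P t y) (P t' y) /\ near_sets e (P t' y) (P t y).
    have [m [M [c b]]] := ghat_curve y (ghatF t ts).
    have [m' [M' [c' b']]] := ghat_curve y (ghatF t' t's).
    apply: hausdorff_near => //; first by exists m; apply: curve_min c.
    by exists m'; apply: curve_min c'.
  apply: (near x).2; apply: le_lt_trans lt_e.
  rewrite /Dist (bigD1 x) //= lerDl; apply: sumr_ge0 => y _.
  exact: (near y).1.
- by move=> t x ts; rewrite /P regF.
Qed.

Section Corners.
Variables (P : (T -> R) -> T -> set (R * R)) (m M : (T -> R) -> T -> R * R).
Hypotheses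
  (P_curve : forall t x, closed_simplex t -> curve (P t x) (m t x) (M t x))
  (P_cont : forall t, closed_simplex t -> forall e : R, 0 < e -> exists2 d : R, 0 < d &
    forall t', closed_simplex t' -> (forall x, `|t x - t' x| < d) ->
    forall x, near_sets e (P t x) (P t' x) /\ near_sets e (P t' x) (P t x))
  (P_reg : forall t x, simplex t -> P t x = closed_graph (F t) x).

Lemma corners_cont x :
  [/\ cont_on closed_simplex (fun t => (m t x).1),
      cont_on closed_simplex (fun t => (m t x).2),
      cont_on closed_simplex (fun t => (M t x).1) &
      cont_on closed_simplex (fun t => (M t x).2)].
Proof.
split=> t ts e e0; have [d d0 dP] := P_cont ts e0; exists d => // t' t's tt';
  have [n1 n2] := dP t' t's tt' x;
  have [a1 a2 a3 a4] := near_corners (P_curve x ts) (P_curve x t's) n1;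
  have [b1 b2 b3 b4] := near_corners (P_curve x t's) (P_curve x ts) n2;
  by apply/ltr_normlP; split; lra.
Qed.

(** The bottom lengths of [F t] are the coordinates of t, because the critical
    values, which are their partial sums, are prescribed. *)
Lemma corners_simplex t x : simplex t ->
  [/\ (m t x).2 = \sum_(y | (pos pi Bot y < pos pi Bot x)%N) t y,
      (M t x).2 = (m t x).2 + t x,
      (m t x).1 = \sum_(y | (pos pi Top y < pos pi Top x)%N) ((M t y).1 - (m t y).1) &
      \sum_y ((M t y).1 - (m t y).1) = 1].
Proof.
move=> ts; have [gietF _ critF _] := full.
have [lo [hi [I loE tot _ cv]]] := giet_curve (gietF t ts).
have mE y : m t y = (lo Top y, lo Bot y) /\ M t y = (hi Top y, hi Bot y).
  apply: curve_corners_uniq (P_curve y (simplex_closed ts)) _.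
  by rewrite P_reg.
have loB y : lo Bot y = \sum_(z | (pos pi Bot z < pos pi Bot y)%N) t z.
  by rewrite -critF // /crit; have [lt_y ->] := I Bot y; rewrite inf_itvco.
have lenB y : hi Bot y - lo Bot y = t y.
  have tel (h : T -> R) (A : pred T) : (forall z, A z = (z == y) ||
      (pos pi Bot z < pos pi Bot y)%N) ->
      \sum_(z | A z) h z = \sum_(z | (pos pi Bot z < pos pi Bot y)%N) h z + h y.
    move=> AE; rewrite (bigD1 y) ?AE ?eqxx //= addrC; congr (_ + _).
    apply: eq_bigl => z; rewrite AE.
    by case: eqVneq => [->|]; rewrite ?ltnn ?andbT.
  have lo_y : \sum_(z | (pos pi Bot z < pos pi Bot y)%N) t z =
      \sum_(z | (pos pi Bot z < pos pi Bot y)%N) (hi Bot z - lo Bot z).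
    by rewrite -loB loE add0r.
  have [lst|/pos_next[y' nxt]] := eqVneq (last_letter (pos pi Bot)) (Some y).
    have allT z : xpredT z = (z == y) || (pos pi Bot z < pos pi Bot y)%N.
      by rewrite pos_last.
    have := tot Bot; rewrite subr0 -[RHS](ts.2) !(tel _ _ allT) lo_y.
    by move/addrI.
  have := loE Bot y'; rewrite add0r loB !(tel _ _ nxt) lo_y.
  by move/addrI.
have [-> ->] := mE x; split=> //=.
- by rewrite -lenB; lra.
- by rewrite loE add0r; apply: eq_bigr => y _; have [-> ->] := mE y.
- by have := tot Top; rewrite subr0 => <-; apply: eq_bigr => y _; have [-> ->] := mE y.
Qed.

Lemma corners_closed t x : closed_simplex t ->
  [/\ (m t x).2 = \sum_(y | (pos pi Bot y < pos pi Bot x)%N) t y,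
      (M t x).2 = (m t x).2 + t x,
      (m t x).1 = \sum_(y | (pos pi Top y < pos pi Top x)%N) ((M t y).1 - (m t y).1) &
      \sum_y ((M t y).1 - (m t y).1) = 1].
Proof.
move=> ts.
have c1 y : cont_on closed_simplex (fun t => (m t y).1) by have [] := corners_cont y.
have c2 y : cont_on closed_simplex (fun t => (m t y).2) by have [] := corners_cont y.
have c3 y : cont_on closed_simplex (fun t => (M t y).1) by have [] := corners_cont y.
have c4 y : cont_on closed_simplex (fun t => (M t y).2) by have [] := corners_cont y.
have cx y : cont_on closed_simplex (fun t => t y).
  exact: cont_on_coord.
split; apply/eqP; rewrite -subr_eq0; apply/eqP.
- apply: (cont_on_zero (h := fun t => (m t x).2 - _)) ts.
    by apply: cont_onB => //; apply: cont_on_sum.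
  by move=> t' t's; have [-> _ _ _] := corners_simplex x t's; rewrite subrr.
- apply: (cont_on_zero (h := fun t => (M t x).2 - ((m t x).2 + t x))) ts.
    by apply: cont_onB => //; apply: cont_onD.
  by move=> t' t's; have [_ -> _ _] := corners_simplex x t's; rewrite subrr.
- apply: (cont_on_zero (h := fun t => (m t x).1 - _)) ts.
    by apply: cont_onB => //; apply: cont_on_sum => y; apply: cont_onB.
  by move=> t' t's; have [_ _ <- _] := corners_simplex x t's; rewrite subrr.
- apply: (cont_on_zero (h := fun t => \sum_y ((M t y).1 - (m t y).1) - 1)) ts.
    apply: cont_onB; last exact: cont_on_cst.
    by apply: cont_on_sum => y; apply: cont_onB.
  by move=> t' t's; have [_ _ _ ->] := corners_simplex x t's; rewrite subrr.
Qed.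

End Corners.
End Family.
End Pieces.

(** * The Thurston map *)
Section Thurston.
Local Open Scope classical_set_scope.
Local Open Scope ring_scope.
Variable R : realType.

Lemma cont_on_family (K J : finType) (X : set (K -> R)) (h : J -> (K -> R) -> R) :
  (forall j, cont_on X (h j)) -> forall g, X g -> forall e : R, 0 < e ->
  exists2 d : R, 0 < d & forall g', X g' -> (forall k, `|g k - g' k| < d) ->
    forall j, `|h j g - h j g'| < e.
Proof.
move=> ch g Xg e e0.
suff [d d0 dP] : exists2 d : R, 0 < d & forall g', X g' ->
    (forall k, `|g k - g' k| < d) -> forall j, j \in enum J -> `|h j g - h j g'| < e.
  by exists d => // g' Xg' gg' j; apply: dP => //; rewrite mem_enum.
elim: (enum J) => [|j s [d d0 IHs]]; first by exists 1.
have [d1 d10 D1] := ch j g Xg e e0.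
exists (Num.min d1 d) => [|g' Xg' gg' j']; first by rewrite lt_min d10.
rewrite inE => /orP[/eqP ->|js].
  by apply: D1 => // k; apply: lt_le_trans (gg' k) _; rewrite ge_min lexx.
by apply: IHs => // k; apply: lt_le_trans (gg' k) _; rewrite ge_min lexx orbT.
Qed.

Lemma offs_telescope (T : finType) (pi : datum T) e (lam : T -> nat) (h : nat -> R) :
  (forall x, \sum_(y | (pos pi e y < pos pi e x)%N)
      (h (offs pi e lam y + lam y)%N - h (offs pi e lam y)) =
    h (offs pi e lam x) - h 0%N) /\
  \sum_y (h (offs pi e lam y + lam y)%N - h (offs pi e lam y)) =
    h (\sum_y lam y)%N - h 0%N.
Proof.
have main n : (n <= #|T|)%N -> \sum_(y | (pos pi e y < n)%N)
      (h (offs pi e lam y + lam y)%N - h (offs pi e lam y)) =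
    h (\sum_(y | (pos pi e y < n)%N) lam y)%N - h 0%N.
  elim: n => [|n IHn] nT; first by rewrite !big_pred0 // subrr.
  pose al := letter pi e (Ordinal nT).
  have pal : pos pi e al = n :> nat by rewrite letterK.
  have split_al y : (pos pi e y < n.+1)%N && (y != al) = (pos pi e y < n)%N.
    rewrite ltnS [RHS]ltn_neqAle andbC -{2}pal.
    by rewrite (inj_eq val_inj) (inj_eq (@pos_inj _ pi _)).
  have offs_al : offs pi e lam al = (\sum_(y | (pos pi e y < n)%N) lam y)%N.
    by rewrite /offs pal.
  have -> : (\sum_(y | (pos pi e y < n.+1)%N) lam y = offs pi e lam al + lam al)%N.
    by rewrite (bigD1 al) ?pal //= addnC (eq_bigl _ _ split_al) offs_al.
  rewrite (bigD1 al) ?pal //= (eq_bigl _ _ split_al) (IHn (ltnW nT)) -offs_al.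
  ring.
split=> [x|]; first exact: main (ltnW (ltn_ord _)).
have all_y y : (pos pi e y < #|T|)%N = xpredT y by rewrite ltn_ord.
by have := main #|T| (leqnn _); rewrite !(eq_bigl _ _ all_y).
Qed.

Section Map.
Variables (T : finType) (pi : datum T) (F : (T -> R) -> pregiet R T) (lam : T -> nat).
Hypotheses (full : full_family pi F) (lam_gt0 : forall x, (0 < lam x)%N).
Variables (P : (T -> R) -> T -> set (R * R)) (m M : (T -> R) -> T -> R * R).
Hypotheses
  (P_curve : forall t x, closed_simplex t -> curve (P t x) (m t x) (M t x))
  (P_cont : forall t, closed_simplex t -> forall e : R, 0 < e -> exists2 d : R, 0 < d &
    forall t', closed_simplex t' -> (forall x, `|t x - t' x| < d) ->
    forall x, near_sets e (P t x) (P t' x) /\ near_sets e (P t' x) (P t x))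
  (P_reg : forall t x, simplex t -> P t x = closed_graph (F t) x).

Local Notation corners := (corners_closed full P_curve P_cont P_reg).

(** The inverse of the branch x at parameter t; the default value of [get]
    matters only outside the vertical projection of the piece. *)
Definition branch_inv t x (y : R) : R := get [set a | P t x (a, y)].

Lemma branch_invP t x y : closed_simplex t -> (m t x).2 <= y <= (M t x).2 ->
  P t x (branch_inv t x y, y).
Proof.
move=> ts yr; have [[a y'] /= Pz yy'] := curve_snd (P_curve x ts) yr.
by rewrite yy' in Pz; have := getI (P := [set a | P t x (a, y)]) Pz.
Qed.

Lemma branch_inv_lt t x y y' : closed_simplex t ->
  (m t x).2 <= y <= (M t x).2 -> (m t x).2 <= y' <= (M t x).2 ->
  (branch_inv t x y < branch_inv t x y') = (y < y').
Proof.
move=> ts yr yr'.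
exact: (curve_mono (P_curve x ts) (branch_invP ts yr) (branch_invP ts yr')).
Qed.

Lemma branch_inv_uniq t x z : closed_simplex t -> P t x z -> branch_inv t x z.2 = z.1.
Proof.
move=> ts Pz; have [_ zr] := curve_box (P_curve x ts) Pz.
exact: (curve_snd_inj (P_curve x ts) (branch_invP ts zr) Pz).
Qed.

Lemma branch_inv_cont t x y : closed_simplex t -> (m t x).2 <= y <= (M t x).2 ->
  forall e : R, 0 < e -> exists2 d : R, 0 < d &
  forall t' y', closed_simplex t' -> (m t' x).2 <= y' <= (M t' x).2 ->
    (forall x, `|t x - t' x| < d) -> `|y - y'| < d ->
    `|branch_inv t x y - branch_inv t' x y'| < e.
Proof.
move=> ts yr e e0; have e2 : 0 < e / 2 by rewrite divr_gt0.
have [d1 d10 D1] := curve_inverse (P_curve x ts) (branch_invP ts yr) e2.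
have d12 : 0 < d1 / 2 by rewrite divr_gt0.
have [|d2 d20 D2] := P_cont ts (e := Num.min (d1 / 2) (e / 2)).
  by rewrite lt_min d12.
exists (Num.min d2 (d1 / 2)) => [|t' y' t's yr' tt' yy']; first by rewrite lt_min d20.
have td2 k : `|t k - t' k| < d2 by apply: lt_le_trans (tt' k) _; rewrite ge_min lexx.
have [_ near_t] := D2 t' t's td2 x.
have [w Pw []] := near_t _ (branch_invP t's yr').
rewrite /= !lt_min => /andP[_ /ltr_normlP[a1 a2]] /andP[/ltr_normlP[b1 b2] _].
move: yy'; rewrite lt_min => /andP[_ /ltr_normlP[c1 c2]].
have /ltr_normlP[f1 f2] : `|branch_inv t x y - w.1| < e / 2.
  by apply: (D1 w Pw); apply/ltr_normlP; split => /=; lra.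
by apply/ltr_normlP; split; lra.
Qed.

Local Notation K := {x : T & 'I_(lam x)}.
Local Notation N := (\sum_x lam x)%N.
Implicit Types (g : K -> R) (k : K).

(** Gaps are indexed by cells and laid out on the line in the order of their
    top positions. *)
Definition marks g (n : nat) : R := \sum_(k | (slot_pos pi Top k < n)%N) g k.

(** The parameter of the family whose critical values are the marked points at
    which the bottom intervals of the model start. *)
Definition bottom_lengths g (x : T) : R :=
  marks g (offs pi Bot lam x + lam x) - marks g (offs pi Bot lam x).

Definition pull_back g (x : T) (i : nat) : R :=
  branch_inv (bottom_lengths g) x (marks g (offs pi Bot lam x + i)).

Definition thurston g k : R :=
  pull_back g (tag k) (tagged k).+1 - pull_back g (tag k) (tagged k).

Lemma marks0 g : marks g 0 = 0.
Proof. by rewrite /marks big_pred0. Qed.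

Lemma marks_all g n : (N <= n)%N -> marks g n = \sum_k g k.
Proof.
by move=> Nn; apply: eq_bigl => k; rewrite (leq_trans (slot_pos_lt pi Top k)).
Qed.

Lemma marks_le g n n' : closed_simplex g -> (n <= n')%N -> marks g n <= marks g n'.
Proof.
move=> [g0 _] nn'; rewrite /marks.
rewrite [leRHS](bigID (fun k => (slot_pos pi Top k < n)%N)) /=.
rewrite (eq_bigl (fun k => (slot_pos pi Top k < n')%N && (slot_pos pi Top k < n)%N)).
  by rewrite lerDl; apply: sumr_ge0.
move=> k; case: (ltnP (slot_pos pi Top k) n) => [kn|]; rewrite ?andbF //.
by rewrite (leq_trans kn nn').
Qed.

Lemma bottom_lengths_simplex g : closed_simplex g -> closed_simplex (bottom_lengths g).
Proof.
move=> gs; split=> [x|]; first by rewrite subr_ge0 marks_le // leq_addr.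
have [_ ->] := offs_telescope pi Bot lam (marks g).
by rewrite marks0 subr0 marks_all //; case: gs.
Qed.

Lemma bottom_range g x : closed_simplex g ->
  (m (bottom_lengths g) x).2 = marks g (offs pi Bot lam x) /\
  (M (bottom_lengths g) x).2 = marks g (offs pi Bot lam x + lam x).
Proof.
move=> gs; have [-> -> _ _] := corners x (bottom_lengths_simplex gs).
have [/(_ x) -> _] := offs_telescope pi Bot lam (marks g).
by rewrite marks0 /bottom_lengths; split; lra.
Qed.

Lemma mark_range g x i : closed_simplex g -> (i <= lam x)%N ->
  (m (bottom_lengths g) x).2 <= marks g (offs pi Bot lam x + i)
    <= (M (bottom_lengths g) x).2.
Proof.
move=> gs ix; have [-> ->] := bottom_range x gs.
by rewrite !marks_le ?leq_addr // leq_add2l.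
Qed.

Lemma pull_back_lt g x i j : closed_simplex g -> (i <= lam x)%N -> (j <= lam x)%N ->
  (pull_back g x i < pull_back g x j) =
  (marks g (offs pi Bot lam x + i) < marks g (offs pi Bot lam x + j)).
Proof.
move=> gs ix jx; apply: branch_inv_lt; last by apply: mark_range.
- exact: bottom_lengths_simplex.
- exact: mark_range.
Qed.

Lemma pull_back_ends g x : closed_simplex g ->
  pull_back g x 0 = (m (bottom_lengths g) x).1 /\
  pull_back g x (lam x) = (M (bottom_lengths g) x).1.
Proof.
move=> gs; have ts := bottom_lengths_simplex gs; have [mE ME] := bottom_range x gs.
rewrite /pull_back addn0 -mE -ME.
by split; apply: branch_inv_uniq => //;
  [exact: curve_min (P_curve x ts) | exact: curve_max (P_curve x ts)].
Qed.

Lemma sum_branch g x j : (j <= lam x)%N ->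
  \sum_(i < lam x | (i < j)%N) (pull_back g x i.+1 - pull_back g x i) =
  pull_back g x j - pull_back g x 0.
Proof.
move=> jx; pose D i := pull_back g x i.+1 - pull_back g x i.
rewrite -(big_ord_widen _ D) // -(big_mkord xpredT D).
exact: telescope_sumr.
Qed.

Lemma sum_thurston g x : closed_simplex g ->
  \sum_(i < lam x) (pull_back g x i.+1 - pull_back g x i) =
  (M (bottom_lengths g) x).1 - (m (bottom_lengths g) x).1.
Proof.
move=> gs; have [<- <-] := pull_back_ends x gs; rewrite -(sum_branch g (leqnn _)).
by apply: eq_bigl => i; rewrite ltn_ord.
Qed.

(** The gaps of the pulled back marked points add up, branch by branch, to the
    lengths of the top intervals. *)
Lemma thurston_simplex g : closed_simplex g -> closed_simplex (thurston g).
Proof.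
move=> gs; split=> [[x i]|].
  rewrite subr_ge0 leNgt pull_back_lt //=; last exact: ltnW.
  by rewrite -leNgt marks_le // addnS.
rewrite /thurston -(sig_big_dep xpredT (fun _ _ => true)
  (fun x (i : 'I_(lam x)) => pull_back g x i.+1 - pull_back g x i)) /=.
rewrite (eq_bigr _ (fun x _ => sum_thurston x gs)).
have [x0 _] : exists x0 : T, True.
  have [[x0 _]] : exists k : K, True; last by exists x0.
  apply: contrapT => none; have [_] := gs; rewrite big_pred0.
    by move/eqP; rewrite eq_sym oner_eq0.
  by move=> k; exfalso; apply: none; exists k.
by have [_ _ _] := corners x0 (bottom_lengths_simplex gs).
Qed.

Lemma marks_cont n : cont_on (@closed_simplex R K) (fun g => marks g n).
Proof. by apply: cont_on_sum => k; apply: cont_on_coord. Qed.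

Lemma pull_back_cont x i : (i <= lam x)%N ->
  cont_on (@closed_simplex R K) (fun g => pull_back g x i).
Proof.
move=> ix g gs e e0.
have [d d0 D] := branch_inv_cont (bottom_lengths_simplex gs) (mark_range gs ix) e0.
have ct y : cont_on (@closed_simplex R K) (fun g => bottom_lengths g y).
  by apply: cont_onB; apply: marks_cont.
have [d1 d10 D1] := cont_on_family ct gs d0.
have [d2 d20 D2] := marks_cont (offs pi Bot lam x + i) gs d0.
exists (Num.min d1 d2) => [|g' g's gg']; first by rewrite lt_min d10.
apply: D; [exact: bottom_lengths_simplex | exact: mark_range | | ].
  by apply: D1 => // k; apply: lt_le_trans (gg' k) _; rewrite ge_min lexx.
by apply: D2 => // k; apply: lt_le_trans (gg' k) _; rewrite ge_min lexx orbT.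
Qed.

Lemma thurston_fixed (k0 : K) :
  exists2 g, closed_simplex g & forall k, thurston g k = g k.
Proof.
apply: brouwer_simplex => //; first exact: thurston_simplex.
by move=> [x i]; apply: cont_onB; apply: pull_back_cont => //; exact: ltnW.
Qed.

(** Summing the fixed point equations over the cells to the left of the mark:
    the complete branches contribute the lengths of their top intervals, the
    branch x contributes a telescoping sum. *)
Lemma fixed_pull_back g x i : closed_simplex g -> (forall k, thurston g k = g k) ->
  (i <= lam x)%N -> marks g (offs pi Top lam x + i) = pull_back g x i.
Proof.
move=> gs fix_g ix; rewrite /marks -(eq_bigr _ (fun k _ => fix_g k)).
pose Q y (j : 'I_(lam y)) := (offs pi Top lam y + j < offs pi Top lam x + i)%N.
rewrite /thurston -(sig_big_dep xpredT Q
  (fun x (i : 'I_(lam x)) => pull_back g x i.+1 - pull_back g x i)) /=.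
rewrite (bigID (fun y => (pos pi Top y < pos pi Top x)%N)) /=.
rewrite [X in _ + X](bigD1 x) ?ltnn //= [X in _ + (_ + X)]big1 ?addr0; last first.
  move=> y /andP[yx xy]; rewrite big_pred0 // => j; apply/negbTE.
  have lt_xy : (pos pi Top x < pos pi Top y)%N.
    rewrite ltn_neqAle leqNgt yx andbT eq_sym.
    by rewrite (inj_eq val_inj) (inj_eq (@pos_inj _ pi Top)).
  rewrite /Q -leqNgt; apply: leq_trans (leq_addr _ _).
  by apply: leq_trans (offs_before lam lt_xy); rewrite leq_add2l.
rewrite (eq_bigl (fun j : 'I_(lam x) => (j < i)%N)); last first.
  by move=> j; rewrite /Q ltn_add2l.
rewrite sum_branch // (pull_back_ends x gs).1.
have [_ _ -> _] := corners x (bottom_lengths_simplex gs).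
rewrite (eq_bigr (fun y => (M (bottom_lengths g) y).1 - (m (bottom_lengths g) y).1)).
  by rewrite addrC subrK.
move=> y yx; have {}yx : (pos pi Top y < pos pi Top x)%N := yx.
rewrite -sum_thurston //; apply: eq_bigl => j.
apply/idP; rewrite /Q; apply: (@leq_trans (offs pi Top lam x)); last exact: leq_addr.
by apply: leq_trans (offs_before lam yx); rewrite ltn_add2l ltn_ord.
Qed.

(** [Z n], the vanishing of the gap of the n-th cell, is invariant under the
    permutation of the cells: by [fixed_pull_back] the gap at a top position is
    the pull-back of the gap at the bottom position. *)
Lemma fixed_increasing g : one_cycle pi lam -> closed_simplex g ->
  (forall k, thurston g k = g k) ->
  forall n, (n < N)%N -> marks g n < marks g n.+1.
Proof.
move=> cyc gs fix_g n nN.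
pose Z n := marks g n.+1 == marks g n.
have Zle i : ~~ Z i = (marks g i < marks g i.+1).
  by rewrite /Z eq_sym lt_neqAle marks_le // andbT eq_sym.
have [] := cyc Z.
- move=> x i ix; apply: negb_inj; rewrite !Zle -!addnS.
  rewrite -(pull_back_lt gs (ltnW ix) ix) !fixed_pull_back //; exact: ltnW.
- move=> ZN; exfalso; have mk0 i : (i <= N)%N -> marks g i = 0.
    elim: i => [_|i IHi iN]; first exact: marks0.
    by rewrite (eqP (ZN i iN)) IHi // ltnW.
  have := mk0 N (leqnn _); rewrite marks_all //; case: gs => _ -> /eqP.
  by rewrite oner_eq0.
by move=> /(_ n nN); rewrite Zle.
Qed.

(** The marked points continued beyond N, so as to be increasing over all
    natural numbers. *)
Definition stretched g (n : nat) : R := marks g n + (n - N)%:R.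

Lemma stretchedE g n : (n <= N)%N -> stretched g n = marks g n.
Proof. by rewrite /stretched -subn_eq0 => /eqP ->; rewrite addr0. Qed.

Lemma fixed_realizes g : one_cycle pi lam -> closed_simplex g ->
  (forall k, thurston g k = g k) ->
  [/\ simplex (bottom_lengths g), {mono stretched g : i j / (i <= j)%N >-> i <= j} &
      realizes (stretched g) pi lam (F (bottom_lengths g))].
Proof.
move=> cyc gs fix_g; have incr := fixed_increasing cyc gs fix_g.
have s_mono : {mono stretched g : i j / (i <= j)%N >-> i <= j}.
  apply/increasing_seqP => n; have [nN|Nn] := ltnP n N.
    by rewrite !stretchedE // ?incr // ltnW.
  rewrite /stretched !marks_all ?ltrD2l ?ltr_nat //; last exact: leqW.
  by rewrite subSn.
have s_offs e x i : (i <= lam x)%N ->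
    stretched g (offs pi e lam x + i) = marks g (offs pi e lam x + i).
  by move=> ix; apply/stretchedE/leq_trans/(offs_total pi e lam x); rewrite leq_add2l.
set t := bottom_lengths g.
have ts : simplex t.
  split=> [x|]; last by case: (bottom_lengths_simplex gs).
  have -> : t x = stretched g (offs pi Bot lam x + lam x) -
      stretched g (offs pi Bot lam x + 0).
    by rewrite !s_offs // addn0.
  by rewrite subr_gt0 ltNge s_mono -ltnNge ltn_add2l.
split=> //; have [gietF _ _ _] := full; have gF := gietF t ts.
have [lo [hi [I _ _ _ cv]]] := giet_curve gF.
have tcs := simplex_closed ts.
have [mE ME] : (forall y, m t y = (lo Top y, lo Bot y)) /\
    (forall y, M t y = (hi Top y, hi Bot y)).
  have cvP y : curve (P t y) (lo Top y, lo Bot y) (hi Top y, hi Bot y).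
    by rewrite P_reg.
  by split=> y; have [] := curve_corners_uniq (P_curve y tcs) (cvP y).
have endsE e y : lo e y = stretched g (offs pi e lam y) /\
    hi e y = stretched g (offs pi e lam y + lam y).
  rewrite s_offs // -[offs pi e lam y in X in _ = X /\ _]addn0 s_offs //.
  have [pb0 pb1] := pull_back_ends y gs; have [bt0 bt1] := bottom_range y gs.
  case: e; last by rewrite addn0 -bt0 -bt1 mE ME.
  by rewrite !fixed_pull_back // pb0 pb1 mE ME.
have gintE e y : gint (F t) e y = cell (stretched g) (offs pi e lam y) (lam y).
  by have [_ ->] := I e y; rewrite /cell; have [-> ->] := endsE e y.
split=> // y; have [_ _ _ /(_ y)[bij homoF _ _]] := gF; split.
- rewrite -!gintE; have [im _ sur] := bij; rewrite predeqE => s; split.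
    by move=> [s' ys <-]; apply: im.
  by move=> /sur[s' ys <-]; exists s'.
- by move=> s s'; rewrite -gintE => ys ys'; apply: homoF; rewrite inE.
move=> i iy; rewrite !s_offs ?(ltnW iy) // (fixed_pull_back gs fix_g (ltnW iy)).
set a := pull_back g y i.
have ya : gint (F t) Top y a.
  rewrite gintE /cell /= in_itv /= /a -(fixed_pull_back gs fix_g (ltnW iy)).
  rewrite -s_offs ?(ltnW iy) // s_mono leq_addr ltNge s_mono -ltnNge ltn_add2l //.
have Pa : P t y (a, gmap (F t) a) by rewrite P_reg //; apply: subset_closure.
have Pb : P t y (a, marks g (offs pi Bot lam y + i)).
  by apply: branch_invP => //; apply: mark_range => //; exact: ltnW.
apply/eqP; rewrite eq_le !leNgt; apply/andP; split; apply/negP.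
  by rewrite -(curve_mono (P_curve y tcs) Pb Pa) ltxx.
by rewrite -(curve_mono (P_curve y tcs) Pa Pb) ltxx.
Qed.

End Map.

(** Any integer model whose cells form a single cycle is realized in a full
    family. *)
Lemma full_family_realizes (T : finType) (pi : datum T)
    (F : (T -> R) -> pregiet R T) (lam : T -> nat) (x0 : T) :
  full_family pi F -> (forall x, (0 < lam x)%N) -> one_cycle pi lam ->
  exists t (x : nat -> R), [/\ simplex t, x 0%N = 0, x (\sum_y lam y)%N = 1,
    {mono x : i j / (i <= j)%N >-> i <= j} & realizes x pi lam (F t)].
Proof.
move=> full lam_gt0 cyc.
have [P [m [M [P_curve P_cont P_reg]]]] := full_family_curves full.
have [g gs fix_g] := thurston_fixed full P_curve P_cont P_reg
  (existT _ x0 (Ordinal (lam_gt0 x0))).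
have [ts s_mono real] := fixed_realizes full lam_gt0 P_curve P_cont P_reg cyc gs fix_g.
exists (bottom_lengths pi g), (stretched pi g); split=> //.
- by rewrite stretchedE // marks0.
- by rewrite stretchedE // marks_all //; case: gs.
Qed.

End Thurston.

Lemma rauzy_class_admissible (T : finType) (C : {set datum T}) :
  rauzy_class C -> {in C, forall pi, admissible pi}.
Proof. by move=> /minsetp /and3P[_ /forall_inP]. Qed.

Theorem theorem4p1 (R : realType) (T : finType) (pi pistar : datum T)
    (C : {set datum T}) (F : (T -> R) -> pregiet R T) (r : nat) (g : rpath T) :
  (2 <= #|T|)%N ->
  admissible pi ->
  rauzy_class C -> pi \in C ->
  pistar \in C -> cyclic_datum pistar ->
  full_family pi F ->
  rauzy_path C g -> rstart g = pi -> rend g = pistar -> size (rarrows g) = r ->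
  exists t : T -> R, simplex t /\ rauzy_path_of pi 0%R 1%R (F t) r = Some g.
Proof.
move=> T2 _ RC _ _ cyc full; case: g => [pi1 s] [_ /= compat] /= epi.
subst pi1 => endE <-; have Cadm := rauzy_class_admissible RC.
have cyc1 : one_cycle pi (lengths s).
  by apply: one_cycle_path T2 Cadm compat _; rewrite endE.
have [x0 _] : exists x0, x0 \in T by apply/card_gt0P/ltnW.
have [t [x [ts xz xN x_mono real]]] :=
  full_family_realizes x0 full (@lengths_gt0 _ s) cyc1.
exists t; split=> //; rewrite /rauzy_path_of.
by have := realizes_path x_mono T2 Cadm compat real; rewrite xz xN => ->.
Qed.
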